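(* Let $\mathfrak{k}=(K_{\mathfrak{k}},\le_{\mathfrak{k}})$ be an abstract elementary class. If $\mu$ is a strong limit cardinal and $\mathrm{cf}(\mu)>\mathrm{LST}_{\mathfrak{k}}$ is a measurable cardinal, then $\mathfrak{k}$ has $(\mu,\mathrm{cf}(\mu))$-amalgamation bases, i.e. the $\mathrm{cf}(\mu)$-majority of $M\in K^{\mathfrak{k}}_\mu$ are amalgamation bases.
   Context: $\mathfrak{k}=(K_{\mathfrak{k}},\le_{\mathfrak{k}})$ is an abstract elementary class (a.e.c.) in a vocabulary $\tau_{\mathfrak{k}}$; an empty model, which is $\le_{\mathfrak{k}}$ every member, is allowed. $\mathrm{LST}_{\mathfrak{k}}$ is its Löwenheim–Skolem–Tarski number (taken to be $\ge|\tau_{\mathfrak{k}}|+\aleph_0$). $K^{\mathfrak{k}}_\lambda=\{M\in K_{\mathfrak{k}}:\|M\|=\lambda\}$. $M_0\in K^{\mathfrak{k}}_\lambda$ is an amalgamation base if whenever $M_0\le_{\mathfrak{k}}M_\ell\in K^{\mathfrak{k}}_\lambda$ for $\ell=1,2$, there is $M_3\in K_{\mathfrak{k}}$ with $M_0\le_{\mathfrak{k}}M_3$ such that both $M_1$ and $M_2$ can be $\le_{\mathfrak{k}}$-embedded into $M_3$ over $M_0$. For a regular cardinal $\kappa$, the $\kappa$-majority of $M\in K^{\mathfrak{k}}_\lambda$ satisfies a property $\psi$ if there is a function $F$ such that: (a) $\mathrm{Dom}(F)=\{M\in K_{\mathfrak{k}}: M$ has universe an ordinal in $[\lambda,\lambda^+)\}$;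 (b) if $M\in\mathrm{Dom}(F)$ then $M\le_{\mathfrak{k}}F(M)\in\mathrm{Dom}(F)$; (c) if $\langle M_\alpha:\alpha\le\kappa\rangle$ is $\le_{\mathfrak{k}}$-increasing continuous, each $M_\alpha\in\mathrm{Dom}(F)$, and $M_{2\alpha+2}=F(M_{2\alpha+1})$ for every $\alpha<\kappa$, then $M_\kappa$ satisfies $\psi$. *)

(* Defs.v *)
From mathcomp Require Import all_boot all_order.
From mathcomp Require Import all_classical.

Set Implicit Arguments.
Unset Strict Implicit.
Unset Printing Implicit Defensive.

Import Order.TTheory.
Local Open Scope order_scope.
Local Open Scope classical_set_scope.
Local Open Scope card_scope.

(* Cardinals and ordinals are represented by types: a cardinal by any type or
   set of that cardinality, an ordinal by a well-ordered [orderType].  The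
   ordinals below an ordinal are its elements, [x] standing for the order type
   of its initial segment [[set y | y < x]]. *)

Definition card_lt T U (A : set T) (B : set U) := ~ (B #<= A).

Definition is_cardinal d (mu : orderType d) :=
  well_founded (fun x y : mu => x < y) /\
  forall x : mu, card_lt [set y : mu | y < x] [set: mu].

(* The order type of [O] is the cardinal successor of the cardinality of [mu]. *)
Definition is_succ_cardinal d1 (mu : orderType d1) d2 (O : orderType d2) :=
  [/\ well_founded (fun x y : O => x < y),
      card_lt [set: mu] [set: O] &
      forall x : O, [set y : O | y < x] #<= [set: mu]].

Definition strong_limit d (mu : orderType d) :=
  [/\ is_cardinal mu,
      [set: nat] #<= [set: mu] &
      forall A : set mu, card_lt A [set: mu] ->
        card_lt [set B : set mu | B `<=` A] [set: mu]].

Definition cofinal d (mu : orderType d) (A : set mu) :=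
  forall x : mu, exists2 y, A y & x <= y.

Definition is_cofinality d1 (mu : orderType d1) d2 (kappa : orderType d2) :=
  [/\ is_cardinal kappa,
      (exists2 A : set mu, cofinal A & A #= [set: kappa]) &
      forall A : set mu, cofinal A -> [set: kappa] #<= A].

Definition measurable_cardinal d (kappa : orderType d) :=
  [/\ is_cardinal kappa,
      card_lt [set: nat] [set: kappa] &
      exists D : set_system kappa,
        [/\ UltraFilter D,
            (forall x, ~ D [set x]) &
            (forall S : set (set kappa), card_lt S [set: kappa] ->
               S `<=` D -> D (\bigcap_(X in S) X))]].

Definition ord_zero d (I : orderType d) (a : I) := forall b : I, a <= b.

Definition ord_succ d (I : orderType d) (a a' : I) :=
  a < a' /\ forall b : I, a < b -> a' <= b.

Definition ord_limit d (I : orderType d) (a : I) :=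
  ~ ord_zero a /\ forall b : I, b < a -> exists2 c, b < c & c < a.

Definition ord_sup d (I : orderType d) (A : set I) (s : I) :=
  (forall b, A b -> b <= s) /\ (forall c, (forall b, A b -> b <= c) -> s <= c).

(* [dbl a] is the ordinal 2a: the product in which 2a = a for limit a, so that
   the ordinals 2a, 2a+1 enumerate all ordinals. *)
Definition ord_double d (I : orderType d) (dbl : I -> I) :=
  [/\ forall a, ord_zero a -> dbl a = a,
      forall a a', ord_succ a a' ->
        exists2 b, ord_succ (dbl a) b & ord_succ b (dbl a') &
      forall a, ord_limit a -> ord_sup [set dbl b | b in [set b | b < a]] (dbl a)].

Record vocabulary := Vocabulary {
  pred_sym : Type;
  fun_sym : Type;
  pred_arity : pred_sym -> nat;
  fun_arity : fun_sym -> nat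
}.

(* A structure whose universe is a (possibly empty) subset of the ambient type
   [T]; structures on the same [T] can be compared literally, e.g. for being a
   submodel or a union.  Function symbols are interpreted by their graphs, so
   that a structure carries no data outside its universe. *)
Record structure (tau : vocabulary) (T : Type) := Structure {
  univ : set T;
  rel_of : forall R : pred_sym tau, set ('I_(pred_arity R) -> T);
  graph_of : forall f : fun_sym tau, set (('I_(fun_arity f) -> T) * T);
  rel_sub : forall R x, @rel_of R x -> forall i, univ (x i);
  graph_sub : forall f x y, @graph_of f (x, y) ->
    (forall i, univ (x i)) /\ univ y;
  graph_total : forall f (x : 'I_(fun_arity f) -> T), (forall i, univ (x i)) ->
    exists y, @graph_of f (x, y);
  graph_fun : forall f x y y',
    @graph_of f (x, y) -> @graph_of f (x, y') -> y = y'
}.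
Arguments univ {tau T}.
Arguments rel_of {tau T} s R.
Arguments graph_of {tau T} s f.

Definition submodel tau T (M N : structure tau T) :=
  [/\ univ M `<=` univ N,
      forall R x, (forall i, univ M (x i)) -> (rel_of M R x <-> rel_of N R x) &
      forall f x y, (forall i, univ M (x i)) -> univ M y ->
        (graph_of M f (x, y) <-> graph_of N f (x, y))].

(* Only the values of [f] on the universe of [M] matter. *)
Definition isomorphism tau T T' (f : T -> T')
    (M : structure tau T) (N : structure tau T') :=
  [/\ set_bij (univ M) (univ N) f,
      forall R x, (forall i, univ M (x i)) ->
        (rel_of M R x <-> rel_of N R (f \o x)) &
      forall g x y, (forall i, univ M (x i)) -> univ M y ->
        (graph_of M g (x, y) <-> graph_of N g (f \o x, f y))].

Definition is_union tau T I (P : set I) (M : I -> structure tau T)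
    (N : structure tau T) :=
  [/\ univ N = \bigcup_(i in P) univ (M i),
      forall R, rel_of N R = \bigcup_(i in P) rel_of (M i) R &
      forall f, graph_of N f = \bigcup_(i in P) graph_of (M i) f].

Definition model_class tau := forall T, structure tau T -> Prop.
Definition model_order tau := forall T, structure tau T -> structure tau T -> Prop.

Definition increasing_continuous tau (le : model_order tau) T
    d (I : orderType d) (M : I -> structure tau T) :=
  (forall i j, i <= j -> le T (M i) (M j)) /\
  (forall i, ord_limit i -> is_union [set j | j < i] M (M i)).

Definition limit_type d (I : orderType d) :=
  [/\ well_founded (fun x y : I => x < y), [set: I] !=set0 &
      forall i : I, exists j : I, i < j].

(* The cardinal |L| is at least |tau| + aleph_0 and witnesses the
   Löwenheim-Skolem-Tarski axiom. *)
Definition LST_bound tau (K : model_class tau) (le : model_order tau) (L : Type) :=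
  [set: (pred_sym tau + fun_sym tau + nat)%type] #<= [set: L] /\
  forall T (M : structure tau T) (A : set T), K T M -> A `<=` univ M ->
    exists N, [/\ le T N M, A `<=` univ N & univ N #<= [set: (A + L)%type]].

(* [aec_K_iso] is an equivalence because, when T' is empty and T is not, the
   empty structures on T and T' are isomorphic by a map T' -> T only. *)
Record aec (tau : vocabulary) := Aec {
  aec_K : model_class tau;
  aec_le : model_order tau;
  aec_K_iso : forall T T' (f : T -> T') (M : structure tau T) (M' : structure tau T'),
    isomorphism f M M' -> (aec_K M <-> aec_K M');
  aec_le_iso : forall T T' (f : T -> T') (M N : structure tau T)
      (M' N' : structure tau T'),
    isomorphism f M M' -> isomorphism f N N' -> aec_le M N -> aec_le M' N';
  aec_le_K : forall T (M N : structure tau T), aec_le M N -> aec_K M /\ aec_K N;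
  aec_le_sub : forall T (M N : structure tau T), aec_le M N -> submodel M N;
  aec_le_refl : forall T (M : structure tau T), aec_K M -> aec_le M M;
  aec_le_trans : forall T (M N P : structure tau T),
    aec_le M N -> aec_le N P -> aec_le M P;
  aec_empty : forall T (M N : structure tau T),
    aec_K M -> aec_K N -> univ M = set0 -> aec_le M N;
  aec_union : forall T d (I : orderType d) (M : I -> structure tau T) N,
    limit_type I -> increasing_continuous aec_le M -> is_union setT M N ->
    aec_K N /\ forall i, aec_le (M i) N;
  aec_union_le : forall T d (I : orderType d) (M : I -> structure tau T) N P,
    limit_type I -> increasing_continuous aec_le M -> is_union setT M N ->
    (forall i, aec_le (M i) P) -> aec_le N P;
  aec_coherence : forall T (M N P : structure tau T),
    submodel M N -> aec_le M P -> aec_le N P -> aec_le M N;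
  aec_LST : exists L : Type, LST_bound aec_K aec_le L
}.
Arguments aec_K {tau} a {T}.
Arguments aec_le {tau} a {T}.

Definition is_LST tau (k : aec tau) (L : Type) :=
  LST_bound (@aec_K tau k) (@aec_le tau k) L /\
  forall L' : Type, LST_bound (@aec_K tau k) (@aec_le tau k) L' ->
    [set: L] #<= [set: L'].

Definition K_card tau (k : aec tau) (lambda : Type) T (M : structure tau T) :=
  aec_K k M /\ univ M #= [set: lambda].

Definition le_embedding tau (k : aec tau) T T' (f : T -> T')
    (M : structure tau T) (N : structure tau T') :=
  exists2 M', aec_le k M' N & isomorphism f M M'.

(* An extension of M0 lives on an arbitrary ambient type, so it is given by a
   <=_k-embedding e of M0; an embedding h of it is over M0 when [h \o e] is the
   chosen embedding e3 of M0 into M3. *)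
Definition amalgamation_base tau (k : aec tau) (lambda : Type)
    T0 (M0 : structure tau T0) :=
  K_card k lambda M0 /\
  forall T1 (M1 : structure tau T1) (e1 : T0 -> T1)
         T2 (M2 : structure tau T2) (e2 : T0 -> T2),
    K_card k lambda M1 -> le_embedding k e1 M0 M1 ->
    K_card k lambda M2 -> le_embedding k e2 M0 M2 ->
    exists T3 (M3 : structure tau T3) (e3 : T0 -> T3)
           (h1 : T1 -> T3) (h2 : T2 -> T3),
      [/\ le_embedding k e3 M0 M3,
          le_embedding k h1 M1 M3, le_embedding k h2 M2 M3,
          (forall x, univ M0 x -> h1 (e1 x) = e3 x) &
          (forall x, univ M0 x -> h2 (e2 x) = e3 x)].

(* When [O] has order type lambda^+, a model on [O] whose universe is an ordinal
   in [lambda, lambda^+) is one whose universe is the initial segment below some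
   [x : O] of cardinality at least lambda. *)
Definition ordinal_model tau (k : aec tau) (lambda : Type) d (O : orderType d)
    (M : structure tau O) :=
  aec_K k M /\
  exists2 x : O, univ M = [set y | y < x] & [set: lambda] #<= [set y : O | y < x].

(* The sequence of length kappa + 1 is split into its terms [M a] for a < kappa
   and its last term [Mtop]. *)
Definition majority tau (k : aec tau) d (lambda : orderType d)
    d' (kappa : orderType d') (psi : forall T, structure tau T -> Prop) :=
  forall dO (O : orderType dO), is_succ_cardinal lambda O ->
  exists F : structure tau O -> structure tau O,
    (forall M, ordinal_model k lambda M ->
       aec_le k M (F M) /\ ordinal_model k lambda (F M)) /\
    (forall (M : kappa -> structure tau O) (Mtop : structure tau O)
            (dbl : kappa -> kappa),
       increasing_continuous (@aec_le tau k) M ->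
       is_union setT M Mtop -> (forall a, aec_le k (M a) Mtop) ->
       (forall a, ordinal_model k lambda (M a)) -> ordinal_model k lambda Mtop ->
       ord_double dbl ->
       (forall a b c, ord_succ (dbl a) b -> ord_succ b c -> M c = F (M b)) ->
       psi O Mtop).

Definition has_amalgamation_bases tau (k : aec tau) d (lambda : orderType d)
    d' (kappa : orderType d') :=
  majority k lambda kappa (@amalgamation_base tau k lambda).

(* Main.v *)
From HB Require Import structures.
Require Import Defs.
From mathcomp Require Import all_boot all_order finmap.
From mathcomp Require Import all_classical.
From mathcomp Require Import wochoice.
Set Implicit Arguments.
Unset Strict Implicit.
Unset Printing Implicit Defensive.
Import Order.TTheory.
Local Open Scope order_scope.
Local Open Scope classical_set_scope.
Local Open Scope card_scope.

(** Let [D] be the measure on [kappa = cf(mu)].  Call a task over an ordinal model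
    [M] a model [N] of size [< mu] together with a bounded set of prescribed values
    in [M] (bounded with respect to an enumeration of [M] in type [mu]).  As [mu] is
    a strong limit there are only [mu] tasks, so Zorn's lemma gives [F M >= M] that
    realizes, by an embedding of [N] into [F M], every task over [M] realized in
    some extension of [F M].

    Let [M] be the union of a chain as in the definition of majority, and let [M1]
    and [M2] extend [M].  For [i, e < kappa] let [N_e <= M1] have size [< mu] and
    contain the first [m_e] elements of [M1], with the [m_e] cofinal in [mu].  The
    pair [N_e], the first [m_e] elements of [M_(2i+1)], is a task over [M_(2i+1)]
    realized in [M1], hence in [F M_(2i+1) <= M]: there is [f_(i,e) : N_e -> M] fixing
    these elements.  Every [x] in [M1] is in [N_e] and every [y] in [M] is fixed by
    [f_(i,e)] for [D]-almost all [i] and [D]-almost all [e], so the [f_(i,e)] induce an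
    embedding of [M1] into the ultrapower of [M2] by [D x D] which agrees on [M] with
    the diagonal embedding of [M2].

    That the ultrapower is in the class, and that these maps are [<=]-embeddings,
    holds because [D] is [LST^+]-complete: the ultrapower is the directed union of
    its substructures of size [<= LST] which are copies of submodels of [M2] at
    almost all coordinates. *)

(** * Well-orders *)
Definition wf_order d (I : orderType d) := well_founded (fun x y : I => x < y).

Lemma wf_order_min d (I : orderType d) (A : set I) :
  wf_order I -> A !=set0 -> exists2 x, A x & forall y, A y -> x <= y.
Proof.
move=> wfI [x0 Ax0]; apply: contrapT => nmin.
suff: forall x, ~ A x by move/(_ x0).
apply: (well_founded_ind wfI) => x IH Ax; apply: nmin; exists x => // y Ay.
by rewrite leNgt; apply/negP => /IH.
Qed.

Section initial_segment.
Context d (I : orderType d) (a : I).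
(** A type of its own, so that it can index a chain of limit length and be the ambient type of a
    small structure. *)
Definition below := {y : I | y < a}.
HB.instance Definition _ := Choice.on below.
HB.instance Definition _ := [isSub of below for sval].
HB.instance Definition _ := [SubChoice_isSubOrder of below by <: with d].

Lemma below_wf : wf_order I -> wf_order below.
Proof.
move=> wfI x; move: {2}(val x) (erefl (val x)) => y.
elim/(well_founded_ind wfI): y x => y IH x xy.
by constructor => z zx; apply: (IH (val z)) => //; rewrite -xy.
Qed.
End initial_segment.

Record wo_rel (T : Type) := WoRel {
  wo_r :> rel T;
  wo_anti : antisymmetric wo_r;
  wo_trans : transitive wo_r;
  wo_total : total wo_r;
  wo_min : forall A : set T, A !=set0 -> exists2 x, A x & forall y, A y -> wo_r x y }.

Lemma wo_rel_exists (T : Type) : inhabited (wo_rel T).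
Proof.
have [r rwo] := @well_ordering_principle {classic T}.
have tot : total r.
  move=> x y; have := @wo_chainW _ r predT; rewrite /chain => h.
  by apply: h => // A _; exact: rwo.
have anti : antisymmetric r.
  move=> x y; have := @wo_chain_antisymmetric _ r predT => h.
  by apply: h => // A _; exact: rwo.
have min (A : set {classic T}) : A !=set0 -> exists2 x, A x & forall y, A y -> r x y.
  move=> [x Ax]; have [|z [[/= /asboolP zA zmin] _]] := rwo [pred u | `[< A u >]].
    by exists x; apply/asboolP.
  by exists z => // y Ay; apply: zmin; apply/asboolP.
constructor; apply: (@WoRel _ r) => //.
(* Transitivity is read off the least of the three points: if it is not [x], antisymmetry identifies
   two of them. *)
move=> y x z rxy ryz; have [|u [->|[->|->]] um] := min [set u | u = x \/ u = y \/ u = z].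
- by exists x; left.
- by apply: um; right; right.
- by rewrite (anti x y) // rxy um //; left.
- have zy : z = y by apply: anti; rewrite ryz um //; right; left.
  by rewrite zy.
Qed.

Section well_ordered_type.
Context (T : Type) (r : wo_rel T).
(** A copy of [T] tagged by [r], on which [r] becomes the canonical order. *)
Definition wo_type of wo_rel T := T.
Local Notation W := (wo_type r).
HB.instance Definition _ := gen_eqMixin W.
HB.instance Definition _ := gen_choiceMixin W.
HB.instance Definition _ := @Order.isOrder.Build Order.default_display W r
  (fun x y => (y != x) && r x y)
  (fun x y => if (y != x) && r x y then x else y)
  (fun x y => if (y != x) && r x y then y else x)
  (fun _ _ => erefl) (fun _ _ => erefl) (fun _ _ => erefl)
  (@wo_anti _ r) (@wo_trans _ r) (@wo_total _ r).
Lemma wo_type_wf : wf_order W.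
Proof.
move=> x; apply: contrapT => nx.
have [y ny ymin] := @wo_min _ r [set y : W | ~ Acc (fun x y : W => x < y) y] (ex_intro _ x nx).
apply: ny; constructor => z zy; apply: contrapT => nz.
have : (y : W) <= z by exact: ymin.
by rewrite leNgt zy.
Qed.
End well_ordered_type.

(** * Unions of structures *)
Lemma structure_eq tau T (M N : structure tau T) :
  univ M = univ N -> rel_of M = rel_of N -> graph_of M = graph_of N -> M = N.
Proof.
case: M => u r g a b c e; case: N => u' r' g' a' b' c' e' /= *; subst.
by f_equal; exact: Prop_irrelevance.
Qed.

Lemma submodel_eq tau T (M N P : structure tau T) :
  submodel M P -> submodel N P -> univ M = univ N -> M = N.
Proof.
move=> [_ rM gM] [_ rN gN] uMN; apply: structure_eq => //.
- apply: functional_extensionality_dep => R; apply/funext => x; apply/propext.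
  split=> h; have ux := rel_sub h; [apply/rN|apply/rM] => //;
  [by rewrite -uMN|exact/rM|by rewrite uMN|exact/rN].
- apply: functional_extensionality_dep => f; apply/funext => -[x y]; apply/propext.
  split=> h; have [ux uy] := graph_sub h; [apply/gN|apply/gM] => //;
  [by rewrite -uMN|by rewrite -uMN|exact/gM|by rewrite uMN|by rewrite uMN|exact/gN].
Qed.

Lemma is_union_unique tau T I (P : set I) (M : I -> structure tau T) N N' :
  is_union P M N -> is_union P M N' -> N = N'.
Proof.
move=> [u r g] [u' r' g']; apply: structure_eq; first by rewrite u u'.
- by apply: functional_extensionality_dep => R; rewrite r r'.
- by apply: functional_extensionality_dep => f; rewrite g g'.
Qed.

Lemma is_union_max tau T I (P : set I) (M : I -> structure tau T) i :
  P i -> (forall j, P j -> submodel (M j) (M i)) -> is_union P M (M i).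
Proof.
move=> Pi sub; split.
- by apply/seteqP; split=> [x Mx|x [j /sub[s _ _] /s//]]; exists i.
- move=> R; apply/seteqP; split=> [x Mx|x [j /sub[s r _] Mx]]; first by exists i.
  by apply/(r _ _ (rel_sub Mx)).
- move=> f; apply/seteqP; split=> [x Mx|[x y] [j /sub[s _ g] Mx]]; first by exists i.
  by have [ux uy] := graph_sub Mx; apply/(g _ _ _ ux uy).
Qed.

Section directed_family.
Context tau T I (P : set I) (M : I -> structure tau T).
Hypothesis P0 : P !=set0.
Hypothesis dirP : forall i j, P i -> P j ->
  exists k, [/\ P k, submodel (M i) (M k) & submodel (M j) (M k)].

(** Arities are finite, so directedness collects the entries of a tuple one by one into a single
    member. *)
Lemma directed_tuple n (x : 'I_n -> T) :
  (forall i, (\bigcup_(j in P) univ (M j)) (x i)) ->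
  exists2 k, P k & forall i, univ (M k) (x i).
Proof.
move=> ux; suff: forall m, exists2 k, P k & forall i : 'I_n, (i < m)%N -> univ (M k) (x i).
  by move=> /(_ n)[k Pk uk]; exists k => // i; apply: uk.
elim=> [|m [k Pk uk]]; first by have [k Pk] := P0; exists k.
case: (ltnP m n) => [mn|nm]; last first.
  by exists k => // i im; apply: uk; exact: leq_trans (ltn_ord i) nm.
have [j Pj uj] := ux (Ordinal mn); have [l [Pl [sk _ _] [sj _ _]]] := dirP Pk Pj.
exists l => // i; rewrite ltnS leq_eqVlt => /orP[/eqP im|/uk/sk//].
by have -> : i = Ordinal mn; [exact/val_inj|exact: sj].
Qed.

Lemma directed_union_exists :
  exists2 N, is_union P M N & forall i, P i -> submodel (M i) N.
Proof.
pose u := \bigcup_(i in P) univ (M i).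
pose r R := \bigcup_(i in P) rel_of (M i) R.
pose g f := \bigcup_(i in P) graph_of (M i) f.
have gsub f x y : g f (x, y) -> (forall i, u (x i)) /\ u y.
  by move=> [i Pi h]; have [ux uy] := graph_sub h; split=> [j|]; exists i.
have rsub R x : r R x -> forall i, u (x i).
  by move=> [i Pi h] j; exists i => //; exact: rel_sub h j.
have gtot f (x : 'I_(fun_arity f) -> T) : (forall i, u (x i)) -> exists y, g f (x, y).
  by move=> /directed_tuple[k Pk ux]; have [y hy] := @graph_total _ _ (M k) f x ux; exists y, k.
have gfun f x y y' : g f (x, y) -> g f (x, y') -> y = y'.
  move=> [i Pi gi] [j Pj gj]; have [k [Pk [_ _ si] [_ _ sj]]] := dirP Pi Pj.
  have [ux uy] := graph_sub gi; have [ux' uy'] := graph_sub gj.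
  by apply: (@graph_fun _ _ (M k) f x); [apply/si|apply/sj].
exists (@Structure _ _ u r g rsub gsub gtot gfun); first by split.
move=> i Pi; split => /=.
- by move=> x ux; exists i.
- move=> R x ux; split=> [h|[j Pj hj]]; first by exists i.
  have [k [Pk [ki ri _] [kj rj _]]] := dirP Pi Pj.
  by apply/(ri _ _ ux); apply/(rj _ _ (rel_sub hj)).
- move=> f x y ux uy; split=> [h|[j Pj hj]]; first by exists i.
  have [k [Pk [ki _ ri] [kj _ rj]]] := dirP Pi Pj.
  have [ux' uy'] := graph_sub hj.
  by apply/(ri _ _ _ ux uy); apply/(rj _ _ _ ux' uy').
Qed.
End directed_family.

(** The axioms of an a.e.c. speak of chains only. Turning a directed family into a monotone one over
    finite sets prepares a transfinite induction on the set of indices used. *)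
Lemma finite_lift_homo tau (k : aec tau) T (I : choiceType) (M : I -> structure tau T) :
  inhabited I -> (forall i, aec_K k (M i)) ->
  (forall i j, exists l, aec_le k (M i) (M l) /\ aec_le k (M j) (M l)) ->
  exists h : {fset I} -> I,
    (forall s t, (s `<=` t)%fset -> aec_le k (M (h s)) (M (h t))) /\
    (forall s i, i \in s -> aec_le k (M i) (M (h s))).
Proof.
move=> [i0] KM dirM.
have ub (s : seq I) : exists l, forall i, i \in s -> aec_le k (M i) (M l).
  elim: s => [|i s [l ls]]; first by exists i0.
  have [m [im lm]] := dirM i l; exists m => j; rewrite inE => /orP[/eqP->//|/ls jl].
  exact: aec_le_trans jl lm.
have [b bP] := choice ub.
(* [g n s] bounds all [g n' t] with [n' < n] and [t] a subset of [s]; taking [n]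
   to be the size of [s] makes it monotone. *)
pose fix g n (s : {fset I}) {struct n} : I :=
  if n is n'.+1 then b ([seq g n' t | t <- enum_fset (fpowerset s)] ++ enum_fset s) else i0.
have gP n s t : (s `<=` t)%fset -> aec_le k (M (g n s)) (M (g n.+1 t)).
  move=> st; apply: bP; rewrite mem_cat; apply/orP; left.
  by apply/mapP; exists s => //; rewrite fpowersetE.
have gle n m s : (n <= m)%N -> aec_le k (M (g n s)) (M (g m s)).
  move=> /subnK <-; elim: (m - n)%N => [|p IH]; first exact: aec_le_refl.
  exact: aec_le_trans IH (gP _ _ _ (fsubset_refl _)).
exists (fun s => g (#|` s|) s)%fset; split=> [s t|s i].
  rewrite fsubEproper => /orP[/eqP->|]; first exact: aec_le_refl.
  move=> /[dup] /fproper_ltn_card; case: (#|` t|)%fset => [//|n sn] /fproper_sub st.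
  exact: aec_le_trans (gle (#|` s|)%fset n s sn) (gP _ _ _ st).
move=> is_; have : (0 < #|` s|)%N by rewrite cardfs_gt0; apply/fset0Pn; exists i.
case: (#|` s|) => [//|n _]; apply: bP; rewrite mem_cat; apply/orP; right; exact: is_.
Qed.

(** * Directed unions in an a.e.c. *)
Lemma fset_chain (I : choiceType) d (J : orderType d) (Q : set J) (B : J -> set I)
    (s : {fset I}) :
  Q !=set0 -> (forall i j, i <= j -> B i `<=` B j) ->
  [set` s] `<=` \bigcup_(j in Q) B j -> exists2 j, Q j & [set` s] `<=` B j.
Proof.
move=> [j0 Qj0] Bmono sB; have := @subset_refl _ [set` s].
rewrite -{1}(@set_fsetK _ s) => _.
suff: forall l : seq I, {subset l <= s} -> exists2 j, Q j & [set` l] `<=` B j.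
  by move=> /(_ (enum_fset s))[//|j Qj h]; exists j.
elim=> [_|i l IH il]; first by exists j0.
have [x xl|j Qj lj] := IH; first by apply: il; rewrite inE xl orbT.
have [|j' Qj' ij'] := sB i; first by apply: il; rewrite inE eqxx.
case: (leP j j') => jj'.
  exists j' => // x /=; rewrite inE => /orP[/eqP->//|xl].
  exact: (Bmono _ _ jj' _ (lj _ xl)).
exists j => // x /=; rewrite inE => /orP[/eqP->//|xl]; last exact: lj.
exact: (Bmono _ _ (ltW jj')).
Qed.

(** * Monotone families indexed by the finite subsets of a well-order *)

Section finitary_union.
Context tau (k : aec tau) (T : Type) d (I : orderType d).
Hypothesis wfI : wf_order I.
Context (M : {fset I} -> structure tau T).
Hypothesis Mmono : forall s t, (s `<=` t)%fset -> aec_le k (M s) (M t).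
(** [G A] collects the [M s] with [s] a finite subset of [A]. It extends [M] from finite sets to all
    sets and commutes with unions of chains, finite sets being compact. *)
Context (G : set I -> structure tau T).
Hypothesis GP : forall A, is_union [set s | [set` s] `<=` A] M (G A).

Let G_fset (s : {fset I}) : G [set` s] = M s.
Proof.
apply: is_union_unique (GP _) _; apply: is_union_max => //= t ts.
by apply: aec_le_sub (Mmono _); apply/fsubsetP => x; exact: ts.
Qed.

Let G_chain d' (J : orderType d') (Q : set J) (B : J -> set I) :
  Q !=set0 -> (forall i j, i <= j -> B i `<=` B j) ->
  is_union Q (G \o B) (G (\bigcup_(j in Q) B j)).
Proof.
move=> Q0 Bmono; have [u r g] := GP (\bigcup_(j in Q) B j).
have E V (F : {fset I} -> set V) :
    \bigcup_(s in [set s | [set` s] `<=` \bigcup_(j in Q) B j]) F s =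
    \bigcup_(j in Q) \bigcup_(s in [set s | [set` s] `<=` B j]) F s.
  apply/seteqP; split=> [x [s /= /(fset_chain Q0 Bmono)[j Qj sj] Fx]|x [j Qj [s /= sj Fx]]].
    by exists j => //; exists s.
  by exists s => //= y /sj By; exists j.
split=> [|R|f]; rewrite ?u ?r ?g E; apply: eq_bigcupr => j _;
  by have [u' r' g'] := GP (B j); rewrite /= ?u' ?r' ?g'.
Qed.

(** The two union axioms of an a.e.c. for the chain of the [G (B j)], which is continuous because
    [B] is. *)
Let G_step d' (J : orderType d') (B : J -> set I) :
  limit_type J -> (forall i j, i <= j -> B i `<=` B j) ->
  (forall j, ord_limit j -> B j = \bigcup_(i in [set i | i < j]) B i) ->
  (forall i j, i <= j -> aec_le k (G (B i)) (G (B j))) ->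
  (forall i, aec_le k (G (B i)) (G (\bigcup_j B j))) /\
  (forall P, (forall i, aec_le k (G (B i)) P) -> aec_le k (G (\bigcup_j B j)) P).
Proof.
move=> limJ Bmono Bcont Ble.
have inc : increasing_continuous (@aec_le tau k) (G \o B).
  split=> // i limi; rewrite {2}/comp [B i]Bcont //; apply: G_chain => //.
  case: limi => + _; rewrite /ord_zero => /existsNP[b /negP]; rewrite -ltNge => bi.
  by exists b.
have un : is_union setT (G \o B) (G (\bigcup_j B j)).
  by apply: G_chain => //; case: limJ => _ + _.
split=> [i|P leP]; first exact: (aec_union limJ inc un).2.
exact: aec_union_le limJ inc un leP.
Qed.

(* Quantifying over the added finite sets [s] lets a successor segment be absorbed
   into [s], so that only limit segments need the union axioms. *)
Let ext (A : set I) :=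
  (forall s t, (s `<=` t)%fset -> aec_le k (G (A `|` [set` s])) (G (A `|` [set` t]))) /\
  (forall P, (forall s, aec_le k (M s) P) -> forall s : {fset I}, aec_le k (G (A `|` [set` s])) P).
Let seg (a : I) := [set y | y < a].

Let setUfset1 (A : set I) b (s : {fset I}) :
  A `|` [set b] `|` [set` s] = A `|` [set` (b |` s)%fset].
Proof.
rewrite -setUA; congr (_ `|` _); apply/seteqP; split=> x /=; rewrite !inE.
  by move=> [->|->]; rewrite ?eqxx ?orbT.
by move=> /orP[/eqP->|xs]; [left|right].
Qed.

Let ext_step d' (J : orderType d') (B : J -> set I) :
  limit_type J -> (forall i j, i <= j -> B i `<=` B j) ->
  (forall j, ord_limit j -> B j = \bigcup_(i in [set i | i < j]) B i) ->
  (forall j, ext (B j)) ->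
  (forall i j, i <= j -> forall s : {fset I},
     aec_le k (G (B i `|` [set` s])) (G (B j `|` [set` s]))) ->
  ext (\bigcup_j B j) /\
  forall i (s : {fset I}), aec_le k (G (B i `|` [set` s])) (G (\bigcup_j B j `|` [set` s])).
Proof.
move=> limJ Bmono Bcont extB Ble.
have E d1 (J1 : orderType d1) (Q : set J1) (B1 : J1 -> set I) (s : {fset I}) : Q !=set0 ->
    \bigcup_(j in Q) B1 j `|` [set` s] = \bigcup_(j in Q) (B1 j `|` [set` s]).
  move=> [q Qq]; apply/seteqP; split=> [x [[j Qj Bx]|sx]|x [j Qj [Bx|sx]]].
  - by exists j => //; left.
  - by exists q => //; right.
  - by left; exists j.
  - by right.
have J0 : [set: J] !=set0 by case: limJ.
have st (s : {fset I}) := @G_step _ _ (fun j => B j `|` [set` s]) limJ _ _ (fun i j ij => Ble i j ij s).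
have {}st (s : {fset I}) : (forall i, aec_le k (G (B i `|` [set` s])) (G (\bigcup_j B j `|` [set` s]))) /\
  (forall P, (forall i, aec_le k (G (B i `|` [set` s])) P) ->
    aec_le k (G (\bigcup_j B j `|` [set` s])) P).
  rewrite E //; apply: st => [? i j ij|? j limj]; first by apply: setSU; exact: Bmono.
  rewrite Bcont // E //; case: limj => + _; rewrite /ord_zero => /existsNP[b /negP].
  by rewrite -ltNge => bi; exists b.
split; last by move=> i s; exact: (st s).1.
split=> [s t ss|P leP s].
  apply: (st s).2 => i; apply: aec_le_trans ((extB i).1 _ _ ss) _; exact: (st t).1.
by apply: (st s).2 => i; exact: (extB i).2.
Qed.

(** Transfinite induction on [a]. At zero only finite sets remain, at a successor the new point is
    absorbed into [s], and at a limit [ext_step] applies to the chain of smaller segments. *)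
Let seg_ext a : ext (seg a) /\
  forall b, b <= a -> forall s : {fset I},
    aec_le k (G (seg b `|` [set` s])) (G (seg a `|` [set` s])).
Proof.
elim/(well_founded_ind wfI): a => a IH.
have refl : ext (seg a) -> forall s : {fset I},
    aec_le k (G (seg a `|` [set` s])) (G (seg a `|` [set` s])).
  by move=> [h _] s; exact: h.
suff: ext (seg a) /\ forall b, b < a -> forall s : {fset I},
    aec_le k (G (seg b `|` [set` s])) (G (seg a `|` [set` s])).
  move=> [ea h]; split=> // b; rewrite le_eqVlt => /orP[/eqP->|/h//]; exact: refl.
have [z|nz] := pselect (ord_zero a).
  have -> : seg a = set0.
    by apply/seteqP; split=> // y /=; rewrite /seg /= ltNge z.
  split; last by move=> b; rewrite ltNge z.
  by split=> [s t st|P leP s]; rewrite !set0U !G_fset //; exact: Mmono.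
have [[b ba bmax]|nb] := pselect (exists2 b, b < a & forall c, c < a -> c <= b).
  have -> : seg a = seg b `|` [set b].
    apply/seteqP; split=> [y /bmax|y [yb|->//]]; last exact: lt_trans yb ba.
    by rewrite le_eqVlt => /orP[/eqP->|]; [right|left].
  have [[eb1 eb2] hb] := IH _ ba; split.
    split=> [s t st|P leP s]; rewrite !setUfset1; last exact: eb2.
    by apply: eb1; apply: fsetUS.
  move=> c /bmax cb s; rewrite setUfset1; apply: aec_le_trans (hb _ cb _) _.
  by apply: eb1; exact: fsubsetUr.
have [a0 a0a] : exists a0, a0 < a.
  by move: nz => /existsNP[b /negP]; rewrite -ltNge => bi; exists b.
have lima b : b < a -> exists2 c, b < c & c < a.
  move=> ba; apply: contrapT => nc; apply: nb; exists b => // c ca.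
  by rewrite leNgt; apply/negP => bc; apply: nc; exists c.
have limJ : limit_type (below a).
  split; first exact: below_wf.
    by exists (exist _ a0 a0a).
  by move=> [b ba]; have [c bc ca] := lima _ ba; exists (exist _ c ca).
have -> : seg a = \bigcup_(j : below a) seg (val j).
  apply/seteqP; split=> [y /lima[c yc ca]|y [[c ca] _ /= yc]].
    by exists (exist _ c ca).
  exact: lt_trans yc ca.
have [] := @ext_step _ (below a) (fun j => seg (val j)) limJ.
- move=> i j ij y /= yi; exact: lt_le_trans yi ij.
- move=> j [_ limj]; apply/seteqP; split=> [y yj|y [i ij yi]]; last exact: lt_trans yi ij.
  have [c yc cj] := limj (exist _ y (lt_trans yj (valP j))) yj.
  by exists c.
- by move=> j; exact: (IH _ (valP j)).1.
- by move=> i j ij s; apply: (IH _ (valP j)).2.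
move=> e le; split=> // b ba s; exact: (le (exist _ b ba)).
Qed.

Lemma finitary_union_aec N : inhabited I -> is_union setT M N ->
  [/\ aec_K k N, forall s, aec_le k (M s) N &
      forall P, (forall s, aec_le k (M s) P) -> aec_le k N P].
Proof.
move=> [i0] unN; have -> : N = G setT.
  by apply: is_union_unique unN _; have := GP setT; congr is_union; apply/seteqP; split.
suff [] : (forall s, aec_le k (M s) (G setT)) /\
    forall P, (forall s, aec_le k (M s) P) -> aec_le k (G setT) P.
  by move=> h1 h2; split=> //; exact: (aec_le_K (h1 fset0)).2.
(* The whole order need not be a segment [seg a]. It is one together with its last element, or else
   of limit type, and then the union axioms apply once more. *)
have [[m mmax]|nm] := pselect (exists m : I, forall i, i <= m).
  have -> : [set: I] = seg m `|` [set` [fset m]%fset].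
    apply/esym/seteqP; split=> // x _; have := mmax x; rewrite le_eqVlt => /orP[/eqP->|].
      by right; rewrite /= inE.
    by left.
  have [[e1 e2] _] := seg_ext m; split=> [s|P /e2//].
  (* The segment of the least element is empty, so [M s] is [G (seg z)] enlarged by [s] and can be
     compared with [seg m] by [seg_ext]. *)
  have [z _ zm] := wf_order_min wfI (ex_intro setT i0 Logic.I).
  have z0 : seg z = set0 by apply/seteqP; split=> // y /=; rewrite /seg /= ltNge zm //.
  rewrite -G_fset -[in aec_le _ _ _](set0U [set` s]) -z0.
  apply: aec_le_trans ((seg_ext m).2 z (mmax _) s) _.
  have -> : seg m `|` [set` [fset m]%fset] = seg m `|` [set` ([fset m] `|` s)%fset].
    apply/seteqP; split=> [x [|/= xm]|x]; first by left.
      by right; rewrite /= inE xm.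
    move=> _; have := mmax x; rewrite le_eqVlt => /orP[/eqP->|]; last by left.
    by right; rewrite /= inE.
  by apply: e1; exact: fsubsetUr.
have limI : limit_type I.
  split=> //; first by exists i0.
  move=> i; apply: contrapT => ni; apply: nm; exists i => j.
  by rewrite leNgt; apply/negP => ij; apply: ni; exists j.
have [] := @ext_step _ I seg limI.
- by move=> i j ij y /= yi; exact: lt_le_trans yi ij.
- move=> j [_ limj]; apply/seteqP; split=> [y yj|y [i ij yi]]; last exact: lt_trans yi ij.
  by have [c yc cj] := limj _ yj; exists c.
- by move=> j; exact: (seg_ext j).1.
- by move=> i j ij; exact: (seg_ext j).2.
have -> : \bigcup_j seg j = setT.
  apply/seteqP; split=> // x _; have [_ _ /(_ x)[j xj]] := limI; by exists j.
move=> [_ e2] le; split=> [s|P /e2/(_ fset0)]; last first.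
  by congr aec_le; congr G; apply/seteqP; split=> // x _; left.
have [z _ zm] := wf_order_min wfI (ex_intro setT i0 Logic.I).
have z0 : seg z = set0 by apply/seteqP; split=> // y /=; rewrite /seg /= ltNge zm //.
have := le z s; rewrite z0 set0U G_fset; congr aec_le; congr G.
by apply/seteqP; split=> // x _; left.
Qed.
End finitary_union.

(** After well-ordering the indices, the family [M \o h] over finite sets is monotone and cofinal in
    the given one, so it has the same union and the same upper bounds. *)
Theorem aec_directed_union tau (k : aec tau) T I (M : I -> structure tau T) N :
  inhabited I ->
  (forall i j, exists l, aec_le k (M i) (M l) /\ aec_le k (M j) (M l)) ->
  is_union setT M N ->
  [/\ aec_K k N, forall i, aec_le k (M i) N &
      forall P, (forall i, aec_le k (M i) P) -> aec_le k N P].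
Proof.
move=> I0 dirM unN; have [r] := wo_rel_exists I.
have KM i : aec_K k (M i) by have [l [/aec_le_K[]]] := dirM i i.
have [h [hmono hmem]] := @finite_lift_homo _ k _ (wo_type r) M I0 KM dirM.
have : forall A : set (wo_type r), exists G,
    is_union [set s : {fset _} | [set` s] `<=` A] (M \o h) G.
  move=> A; have [| |G GP _] := @directed_union_exists _ _ _ [set s | [set` s] `<=` A] (M \o h).
  - by exists fset0 => x.
  - move=> s t /= sA tA; exists (s `|` t)%fset; split=> [x||].
    + by rewrite /= inE => /orP[/sA|/tA].
    + by apply: (aec_le_sub (a := k)); apply: hmono; exact: fsubsetUl.
    + by apply: (aec_le_sub (a := k)); apply: hmono; exact: fsubsetUr.
  by exists G.
move=> /choice[G GP].
have un : is_union setT (M \o h) N.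
  have sub i : exists s : {fset wo_type r}, submodel (M i) (M (h s)).
    exists [fset (i : wo_type r)]%fset; apply: (aec_le_sub (a := k)).
    by apply: hmem; rewrite inE.
  have [u rr g] := unN; split=> [|R|f]; rewrite ?u ?rr ?g; apply/seteqP; split.
  - by move=> x [i _ Mx]; have [s [su _ _]] := sub i; exists s => //; exact: su.
  - by move=> x [s _ Mx]; exists (h s).
  - move=> x [i _ Mx]; have [s [_ sr _]] := sub i; exists s => //.
    by apply/(sr _ _ (rel_sub Mx)).
  - by move=> x [s _ Mx]; exists (h s).
  - move=> [x y] [i _ Mx]; have [s [_ _ sg]] := sub i; exists s => //.
    by have [ux uy] := graph_sub Mx; apply/(sg _ _ _ ux uy).
  - by move=> x [s _ Mx]; exists (h s).
have [KN leN leP] := finitary_union_aec (@wo_type_wf _ r) hmono GP I0 un.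
have sub i : aec_le k (M i) (M (h [fset (i : wo_type r)]%fset)).
  by apply: hmem; rewrite inE.
split=> // [i|P leMP]; first exact: aec_le_trans (sub i) (leN _).
by apply: leP => s; exact: leMP.
Qed.

(** * Isomorphisms and embeddings *)
Lemma set_injP T T' (A : set T) (f : T -> T') :
  set_inj A f <-> forall x y, A x -> A y -> f x = f y -> x = y.
Proof.
split=> [h x y Ax Ay|h x y]; first by apply: h; exact: mem_set.
by move=> /set_mem Ax /set_mem Ay; exact: h.
Qed.

(** These sets are exactly the universes of submodels of [N]. *)
Definition fclosed tau T (N : structure tau T) (A : set T) :=
  A `<=` univ N /\
  forall f x y, (forall i, A (x i)) -> graph_of N f (x, y) -> A y.

Lemma submodel_fclosed tau T (M N : structure tau T) :
  submodel M N -> fclosed N (univ M).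
Proof.
move=> [u _ g]; split=> // f x y ux gN; have [z gM] := @graph_total _ _ M f x ux.
have [_ uz] := graph_sub gM.
by rewrite (@graph_fun _ _ N f x y z gN) //; apply/(g _ _ _ ux uz).
Qed.

Lemma fclosed_submodel tau T (N : structure tau T) (A : set T) :
  fclosed N A -> exists2 M, submodel M N & univ M = A.
Proof.
move=> [AN clA].
pose r R := [set x : 'I_(pred_arity R) -> T | (forall i, A (x i)) /\ rel_of N R x].
pose g f := [set p : ('I_(fun_arity f) -> T) * T | (forall i, A (p.1 i)) /\ graph_of N f p].
have rsub R x : r R x -> forall i, A (x i) by case.
have gsub f x y : g f (x, y) -> (forall i, A (x i)) /\ A y.
  by move=> [/= Ax gx]; split=> //; exact: clA Ax gx.
have gtot f (x : 'I_(fun_arity f) -> T) : (forall i, A (x i)) -> exists y, g f (x, y).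
  move=> Ax; have [y gy] := @graph_total _ _ N f x (fun i => AN _ (Ax i)).
  by exists y.
have gfun f x y y' : g f (x, y) -> g f (x, y') -> y = y'.
  by move=> [_ gy] [_ gy']; exact: graph_fun gy gy'.
exists (@Structure _ _ A r g rsub gsub gtot gfun) => //; split=> //=.
- by move=> R x Ax; split=> [[]|].
- by move=> f x y Ax Ay; split=> [[]|].
Qed.

Lemma submodel_sub tau T (M N P : structure tau T) :
  submodel M P -> submodel N P -> univ M `<=` univ N -> submodel M N.
Proof.
move=> [u r g] [u' r' g'] MN; split=> //.
- by move=> R x ux; rewrite r // r' // => i; exact: MN.
- by move=> f x y ux uy; rewrite g // g' // => [i|]; exact: MN.
Qed.

Lemma image_structure tau T T' (f : T -> T') (M : structure tau T) :
  set_inj (univ M) f ->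
  exists2 M', univ M' = f @` univ M & isomorphism f M M'.
Proof.
move=> /set_injP finj.
pose r R := [set y : 'I_(pred_arity R) -> T' | exists2 x, rel_of M R x & y = f \o x].
pose g h := [set p : ('I_(fun_arity h) -> T') * T' |
  exists x w, [/\ graph_of M h (x, w), p.1 = f \o x & p.2 = f w]].
have rsub R x : r R x -> forall i, (f @` univ M) (x i).
  by move=> [y ry ->] i; exists (y i) => //; exact: rel_sub ry i.
have gsub h x y : g h (x, y) -> (forall i, (f @` univ M) (x i)) /\ (f @` univ M) y.
  move=> [x' [w [gx /= -> ->]]]; have [ux uw] := graph_sub gx.
  by split=> [i|]; [exists (x' i)|exists w].
have gtot h (x : 'I_(fun_arity h) -> T') :
    (forall i, (f @` univ M) (x i)) -> exists y, g h (x, y).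
  move=> ux; have /choice[x' xx'] : forall i, exists t, univ M t /\ f t = x i.
    by move=> i; have [t] := ux i; exists t.
  have [w gw] := @graph_total _ _ M h x' (fun i => (xx' i).1).
  exists (f w), x', w; split=> //=; by apply/funext => i /=; rewrite (xx' i).2.
have inj n (x x' : 'I_n -> T) : (forall i, univ M (x i)) -> (forall i, univ M (x' i)) ->
    f \o x = f \o x' -> x = x'.
  move=> ux ux' e; apply/funext => i; apply: finj => //.
  by have := congr1 (fun z => z i) e.
have gfun h x y y' : g h (x, y) -> g h (x, y') -> y = y'.
  move=> [x1 [w1 [g1 /= -> ->]]] [x2 [w2 [g2 /= e ->]]].
  have [ux1 uw1] := graph_sub g1; have [ux2 uw2] := graph_sub g2.
  by move: (inj _ _ _ ux1 ux2 e) g1 => -> g1; rewrite (graph_fun g1 g2).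
exists (@Structure _ _ (f @` univ M) r g rsub gsub gtot gfun) => //; split=> //=.
- by split=> [x ux||//]; [exists x|exact/set_injP].
- move=> R x ux; split=> [rx|[x' rx' e]]; first by exists x.
  by rewrite (inj _ _ _ ux _ e) //; exact: rel_sub.
- move=> h x y ux uy; split=> [gx|[x' [w [gx /= e1 e2]]]]; first by exists x, y.
  have [ux' uw] := graph_sub gx.
  by rewrite (inj _ _ _ ux ux' e1) // (finj _ _ uy uw e2).
Qed.

Lemma isomorphism_univ tau T T' (f : T -> T') (M : structure tau T) (M' : structure tau T') :
  isomorphism f M M' -> univ M' = f @` univ M.
Proof.
by move=> [[fM _ sM] _ _]; apply/seteqP; split=> // y [x Mx <-]; exact: fM.
Qed.

Lemma isomorphism_lift tau T T' (f : T -> T') (M : structure tau T) (M' : structure tau T') n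
    (y : 'I_n -> T') :
  isomorphism f M M' -> (forall i, univ M' (y i)) ->
  exists2 x, (forall i, univ M (x i)) & y = f \o x.
Proof.
move=> iso uy; have /choice[x xP] : forall i, exists t, univ M t /\ f t = y i.
  by move=> i; have := uy i; rewrite (isomorphism_univ iso) => -[t]; exists t.
by exists x => [i|]; [exact: (xP i).1|apply/funext => i; rewrite /= (xP i).2].
Qed.

Lemma isomorphism_comp tau T1 T2 T3 (f : T1 -> T2) (g : T2 -> T3)
    (M : structure tau T1) N P :
  isomorphism f M N -> isomorphism g N P -> isomorphism (g \o f) M P.
Proof.
move=> [[fM /set_injP iM sM] rM gM] [[fN /set_injP iN sN] rN gN]; split.
- split.
  + by move=> x ux; apply: fN; exact: fM.
  + by apply/set_injP => x y ux uy e; apply: iM => //; apply: iN e; exact: fM.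
  + by move=> z /sN[y /sM[x ux <-] <-]; exists x.
- by move=> R x ux; rewrite rM // rN // => i; exact: fM.
- by move=> h x y ux uy; rewrite gM // gN // => [i|]; exact: fM.
Qed.

Lemma isomorphism_eq_on tau T T' (f g : T -> T') (M : structure tau T) (N : structure tau T') :
  (forall x, univ M x -> f x = g x) -> isomorphism f M N -> isomorphism g M N.
Proof.
move=> fg [[fM /set_injP iM sM] rM gM].
have E n (x : 'I_n -> T) : (forall i, univ M (x i)) -> f \o x = g \o x.
  by move=> ux; apply/funext => i /=; exact: fg.
split.
- split.
  + by move=> x ux; rewrite -fg //; exact: fM.
  + by apply/set_injP => x y ux uy; rewrite -!fg //; exact: iM.
  + by move=> y /sM[x ux <-]; exists x => //; rewrite fg.
- by move=> R x ux; rewrite rM // E.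
- by move=> h x y ux uy; rewrite gM // E // fg.
Qed.

Lemma isomorphism_id tau T (M : structure tau T) : isomorphism id M M.
Proof.
by split=> //; split=> // x ux; exists x.
Qed.

(** A point of [T] is required as the value of the inverse outside the universe of [N]. *)
Lemma isomorphism_inverse tau T T' (f : T -> T') (M : structure tau T) (N : structure tau T') :
  inhabited T -> isomorphism f M N -> exists g,
  [/\ isomorphism g N M, forall x, univ M x -> g (f x) = x &
      forall y, univ N y -> univ M (g y) /\ f (g y) = y].
Proof.
move=> [t0] iso; have u := isomorphism_univ iso.
have /choice[g gP] : forall y, exists x, univ N y -> univ M x /\ f x = y.
  move=> y; have [uy|] := pselect (univ N y); last by exists t0.
  by move: (uy); rewrite u => -[x ux xy]; exists x.
have [[fM /set_injP iM _] rM gM] := iso.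
have gK x : univ M x -> g (f x) = x.
  by move=> ux; have [ug e] := gP _ (fM _ ux); exact: iM.
have gE n (y : 'I_n -> T') : (forall i, univ N (y i)) -> f \o (g \o y) = y.
  by move=> uy; apply/funext => i /=; rewrite (gP _ (uy i)).2.
exists g; split=> //; split.
- split.
  + by move=> y /gP[].
  + by apply/set_injP => x y /gP[_ {2}<-] /gP[_ {2}<-] ->.
  + by move=> x ux; exists (f x); rewrite ?gK //; exact: fM.
- by move=> R y uy; rewrite rM ?gE // => i; exact: (gP _ (uy i)).1.
- move=> h y z uy uz; rewrite gM ?gE ?(gP _ uz).2 // => [i|]; last exact: (gP _ uz).1.
  exact: (gP _ (uy i)).1.
Qed.

Lemma submodel_isomorphism tau T T' (f : T -> T') (M N : structure tau T)
    (M' N' : structure tau T') :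
  submodel M N -> isomorphism f M M' -> isomorphism f N N' -> submodel M' N'.
Proof.
move=> [u r g] iM iN; have [_ rM gM] := iM; have [[fN _ _] rN gN] := iN; split.
- by rewrite (isomorphism_univ iM) => y [x ux <-]; apply: fN; exact: u.
- move=> R y /(isomorphism_lift iM)[x ux ->].
  by rewrite -rM // -rN ?r // => i; exact: u.
- move=> h y z /(isomorphism_lift iM)[x ux ->].
  rewrite (isomorphism_univ iM) => -[w uw <-].
  by rewrite -gM // -gN ?g // => [i|]; exact: u.
Qed.

Section aec_embeddings.
Context tau (k : aec tau).

(** The axiom transports the order forwards along one map, so it is applied to the inverse of [f].
    If [T] is empty there is no inverse map, but then both models are empty. *)
Lemma aec_le_iso_inv T T' (f : T -> T') (M N : structure tau T) (M' N' : structure tau T') :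
  submodel M N -> isomorphism f M M' -> isomorphism f N N' ->
  aec_le k M' N' -> aec_le k M N.
Proof.
move=> sMN iM iN le'.
have [KM' KN'] := aec_le_K le'.
have KM : aec_K k M by apply/(aec_K_iso k iM).
have KN : aec_K k N by apply/(aec_K_iso k iN).
have [t0|nT] := pselect (inhabited T); last first.
  by apply: aec_empty => //; apply/seteqP; split=> // x _; apply: nT; exists.
have [g [ig gf fg]] := isomorphism_inverse t0 iN.
apply: (aec_le_iso _ ig le').
have [g' [ig' g'f fg']] := isomorphism_inverse t0 iM.
apply: isomorphism_eq_on ig' => y uy; have [ug e] := fg' _ uy.
rewrite -{2}e gf //; have [s _ _] := sMN; exact: s.
Qed.

Lemma aec_le_embedding T (M N : structure tau T) : aec_le k M N -> le_embedding k id M N.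
Proof. by exists M => //; exact: isomorphism_id. Qed.

Lemma le_embedding_isomorphism T T' (f : T -> T') (M : structure tau T) (N : structure tau T') :
  aec_K k M -> isomorphism f M N -> le_embedding k f M N.
Proof. by move=> KM i; exists N => //; apply: aec_le_refl; apply/(aec_K_iso k i). Qed.

Lemma le_embedding_comp T1 T2 T3 (f : T1 -> T2) (g : T2 -> T3)
    (M : structure tau T1) N P :
  le_embedding k f M N -> le_embedding k g N P -> le_embedding k (g \o f) M P.
Proof.
move=> [M' M'N iM] [N' N'P iN].
have [s _ _] := aec_le_sub M'N.
have [|M'' _ iM''] := @image_structure _ _ _ g M'.
  apply/set_injP => x y ux uy; have [[_ /set_injP inj _] _ _] := iN.
  by apply: inj; exact: s.
exists M''; last exact: isomorphism_comp iM iM''.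
apply: aec_le_trans N'P; exact: aec_le_iso iM'' iN M'N.
Qed.

Lemma le_embedding_sub T T' (f : T -> T') (M N : structure tau T) (P : structure tau T') :
  aec_le k M N -> le_embedding k f N P -> le_embedding k f M P.
Proof. by move=> /aec_le_embedding; exact: le_embedding_comp. Qed.

Lemma le_embedding_le T T' (f : T -> T') (M : structure tau T) (N P : structure tau T') :
  le_embedding k f M N -> aec_le k N P -> le_embedding k f M P.
Proof. by move=> + /aec_le_embedding; exact: le_embedding_comp. Qed.

End aec_embeddings.

(** * Ultrapowers in an a.e.c. *)
Lemma card_le_set_type T U (A : set T) (B : set U) :
  A #<= B <-> exists f : A -> B, injective f.
Proof.
split=> [/card_leP/injfunPex[f _ /set_injP fI]|[f fI]].
  by exists f => x y; exact: fI.
by apply/card_leP/injfunPex; exists f => // x y _ _; exact: fI.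
Qed.

Lemma card_le_fun T U (A : set T) (B : set U) : inhabited U ->
  A #<= B <-> exists2 f : T -> U, (forall x, A x -> B (f x)) &
    (forall x y, A x -> A y -> f x = f y -> x = y).
Proof.
move=> [u0]; split=> [/card_le_set_type[f fI]|[f fB fI]]; last first.
  apply/card_le_set_type.
  exists (fun x : A => SigSub (mem_set (fB _ (set_mem (valP x)))) : B).
  move=> x y /(congr1 val)/= e; apply: val_inj; apply: fI e; exact: set_mem (valP _).
exists (fun x => if pselect (A x) is left Ax then val (f (SigSub (mem_set Ax))) else u0).
  by move=> x Ax; case: pselect => // Ax'; exact: set_mem (valP _).
move=> x y Ax Ay; case: pselect => // Ax'; case: pselect => // Ay'.
by move=> /val_inj/fI/(congr1 val).
Qed.

(** * Complete ultrafilters *)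

Section ultrafilter_on_index.
Context (J : Type) (W : set (set J)).
Hypothesis WS : forall A B, A `<=` B -> W A -> W B.
Hypothesis WU : forall A, W A \/ W (~` A).
Hypothesis W0 : ~ W set0.

(* Stands for "[A] has cardinality below the completeness of [W]" and spares
   cardinal arithmetic. *)
Definition complete_for T (A : set T) :=
  forall X : T -> set J, (forall x, A x -> W (X x)) ->
    W [set j | forall x, A x -> X x j].

Let WT : W setT.
Proof. by have [|] := WU setT; rewrite ?setCT. Qed.

Lemma complete_card T U (A : set T) (B : set U) :
  A #<= B -> complete_for B -> complete_for A.
Proof.
move=> AB cB X WX; have [U0|nU] := pselect (inhabited U); last first.
  apply: WS WT => j _ x Ax; exfalso; apply: nU.
  by have /card_le_set_type[f _] := AB; exists; exact: val (f (SigSub (mem_set Ax))).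
have [f fB fI] := (card_le_fun A B U0).1 AB.
(* The family is moved to [B] along the injection: at [y] it asks for [X x] at the only possible
   preimage [x] of [y], and for nothing if there is none. *)
apply: WS (cB (fun y => [set j | forall x, A x -> f x = y -> X x j]) _).
  by move=> j h x Ax; exact: (h (f x) (fB _ Ax) x).
move=> y _; have [[x [Ax fx]]|nx] := pselect (exists x, A x /\ f x = y).
  by apply: WS (WX x Ax) => j Xj x' Ax' fx'; rewrite (fI x' x) // fx fx'.
by apply: WS WT => j _ x Ax fx; exfalso; apply: nx; exists x.
Qed.

Lemma complete_image T U (A : set T) (f : T -> U) :
  complete_for A -> complete_for (f @` A).
Proof. by apply: complete_card; exact: card_image_le. Qed.

Lemma complete_set_type T (A : set T) : complete_for A -> complete_for [set: A].
Proof. by apply: complete_card; have := card_setT A; rewrite card_eq_le => /andP[]. Qed.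

Hypothesis W_nat : complete_for [set: nat].

(** Finite intersections come from completeness for [nat], applied to the sequence [A], [B], [B],
    and so on. *)
Lemma WI A B : W A -> W B -> W (A `&` B).
Proof.
move=> WA WB; apply: WS (W_nat (X := fun n => if n is 0 then A else B) _).
  by move=> j h; split; [exact: (h 0)|exact: (h 1)].
by case.
Qed.

Lemma W_ex A : W A -> exists j, A j.
Proof.
move=> WA; apply: contrapT => nA; apply: W0; apply: WS WA => j Aj.
by apply: nA; exists j.
Qed.

Lemma W_not A : ~ W A -> W (~` A).
Proof. by have [] := WU A. Qed.

(** The dual form of completeness: a union of few sets belongs to the ultrafilter only if one of
    them does. *)
Lemma W_some T (A : set T) (X : T -> set J) : complete_for A ->
  W [set j | exists2 x, A x & X x j] -> exists2 x, A x & W (X x).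
Proof.
move=> cA WX; apply: contrapT => nX.
have Wn : W [set j | forall x, A x -> (~` X x) j].
  by apply: cA => x Ax; apply: W_not => WXx; apply: nX; exists x.
have [j [/= h [x Ax Xj]]] := W_ex (WI Wn WX).
exact: h Ax Xj.
Qed.

Lemma complete_sum T U : complete_for [set: T] -> complete_for [set: U] ->
  complete_for [set: (T + U)%type].
Proof.
move=> cT cU X WX.
have h1 := cT (fun x => X (inl x)) (fun x _ => WX _ Logic.I).
have h2 := cU (fun x => X (inr x)) (fun x _ => WX _ Logic.I).
by apply: WS (WI h1 h2) => j [a b] [x|x] _; [exact: a|exact: b].
Qed.

Lemma complete_option T : complete_for [set: T] -> complete_for [set: option T].
Proof.
move=> cT X WX.
have h1 := cT (fun x => X (Some x)) (fun x _ => WX _ Logic.I).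
by apply: WS (WI h1 (WX None Logic.I)) => j [a b] [x|] _; [exact: a|exact: b].
Qed.

Lemma complete_range_ord n T (x : 'I_n -> T) : complete_for (range x).
Proof.
apply: complete_image; apply: complete_card W_nat.
apply/card_le_fun; first by exists; exact: 0.
by exists val => // i j _ _ /val_inj.
Qed.

Lemma complete_set1 T (x : T) : complete_for [set x].
Proof. by move=> X /(_ x erefl) WX; apply: WS WX => j Xj y ->. Qed.

Lemma complete_set0 T : complete_for (@set0 T).
Proof. by move=> X _; apply: WS WT => j _ x []. Qed.

Lemma complete_setU T (A B : set T) :
  complete_for A -> complete_for B -> complete_for (A `|` B).
Proof.
move=> cA cB X WX.
have h1 := cA _ (fun x Ax => WX _ (or_introl Ax)).
have h2 := cB _ (fun x Bx => WX _ (or_intror Bx)).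
by apply: WS (WI h1 h2) => j [a b] x [Ax|Bx]; [exact: a|exact: b].
Qed.

Lemma complete_tuples T (A : set T) n : complete_for A ->
  complete_for [set x : 'I_n -> T | forall i, A (x i)].
Proof.
move=> cA; elim: n => [|n IH] X WX.
  have [[x0 _]|nx] := pselect (exists x0 : 'I_0 -> T, True); last first.
    by apply: WS WT => j _ x _; exfalso; apply: nx; exists x.
  have -> : X = fun=> X x0.
    by apply/funext => x; congr (X _); apply/funext => -[].
  by apply: WS (WX x0 _) => [j Xj x|] // [].
(* [c t x] is the tuple [x] with [t] put in front. *)
pose c t (x : 'I_n -> T) (i : 'I_n.+1) := if unlift ord0 i is Some j then x j else t.
have h : W [set j | forall t, A t -> [set j | forall x, (forall i, A (x i)) -> X (c t x) j] j].
  apply: cA => t At; apply: IH => x Ax; apply: WX => i.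
  by rewrite /c; case: unliftP.
apply: WS h => j h x Ax; have := h (x ord0) (Ax _) (fun i => x (lift ord0 i)) (fun i => Ax _).
congr (X _ j); apply/funext => i; rewrite /c.
by case: unliftP => [i' ->|->].
Qed.

(** * The ultrapower of a model *)

Section ultrapower.
Context tau (k : aec tau) (L : Type).
Hypothesis kL : LST_bound (@aec_K tau k) (@aec_le tau k) L.
Hypothesis W_L : complete_for [set: L].
Context T (M : structure tau T) (t0 : T).
Hypotheses (KM : aec_K k M) (t0M : univ M t0).

Let W_sym : complete_for [set: (pred_sym tau + fun_sym tau + nat)%type].
Proof. by apply: complete_card W_L; case: kL. Qed.

Let W_pred : complete_for [set: pred_sym tau].
Proof.
apply: complete_card W_sym; apply/card_le_fun; first by exists; right; exact: 0.
by exists (fun R => inl (inl R)) => // ? ? _ _ [].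
Qed.

Let W_fun : complete_for [set: fun_sym tau].
Proof.
apply: complete_card W_sym; apply/card_le_fun; first by exists; right; exact: 0.
by exists (fun R => inl (inr R)) => // ? ? _ _ [].
Qed.

(** The Löwenheim-Skolem-Tarski axiom with smallness expressed by completeness. *)
Lemma LST_complete T1 (N : structure tau T1) A : aec_K k N -> A `<=` univ N ->
  complete_for A -> exists E, [/\ aec_le k E N, A `<=` univ E & complete_for (univ E)].
Proof.
move=> KN AN cA; have [E [EN AE EAL]] := kL.2 _ N A KN AN.
exists E; split=> //; apply: complete_card EAL _.
by apply: complete_sum => //; exact: complete_set_type.
Qed.

Definition ae_eq (x y : J -> T) := W [set j | x j = y j].

Let ae_eq_sym x y : ae_eq x y -> ae_eq y x.
Proof. by apply: WS => j /= ->. Qed.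

Let ae_eq_trans y x z : ae_eq x y -> ae_eq y z -> ae_eq x z.
Proof. by move=> xy yz; apply: WS (WI xy yz) => j [e1 e2]; exact: etrans e1 e2. Qed.

(** Chosen representatives take the place of a quotient type, so the ultrapower lives on functions
    from [J] to [T]. *)
Lemma ae_eq_repr : exists r : (J -> T) -> (J -> T),
  (forall x, ae_eq x (r x)) /\ (forall x y, ae_eq x y -> r x = r y).
Proof.
have /choice[c cP] : forall C : set (J -> T), exists x, C !=set0 -> C x.
  move=> C; have [[x Cx]|nC] := pselect (C !=set0); first by exists x.
  by exists (fun=> t0).
exists (fun x => c (ae_eq x)); split=> [x|x y xy].
  by apply: (cP (ae_eq x)); exists x; apply: WS WT.
congr c; apply/funext => z; apply/propext; split; apply: ae_eq_trans => //.
exact: ae_eq_sym.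
Qed.

Context (r : (J -> T) -> (J -> T)).
Hypothesis r_ae : forall x, ae_eq x (r x).
Hypothesis r_eq : forall x y, ae_eq x y -> r x = r y.

(** A representative may leave the universe of [M] on a null set of coordinates. *)
Definition ultrapower_univ := [set u : J -> T | r u = u /\ W [set j | univ M (u j)]].
Local Notation uU := ultrapower_univ.

Definition is_ultrapower (U : structure tau (J -> T)) :=
  [/\ univ U = uU,
      forall R x, (forall i, uU (x i)) ->
        (rel_of U R x <-> W [set j | rel_of M R (fun i => x i j)]) &
      forall f x y, (forall i, uU (x i)) -> uU y ->
        (graph_of U f (x, y) <-> W [set j | graph_of M f (fun i => x i j, y j)])].

Let uU_eq u v : uU u -> uU v -> ae_eq u v -> u = v.
Proof. by move=> [ru _] [rv _] uv; rewrite -ru -rv; exact: r_eq. Qed.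

Let r_uU x : W [set j | univ M (x j)] -> uU (r x).
Proof.
move=> Wx; split; first exact/esym/r_eq/r_ae.
by apply: WS (WI Wx (r_ae x)) => j [Mx e] /=; rewrite -e.
Qed.

Lemma ultrapower_exists : exists U, is_ultrapower U.
Proof.
pose rl R := [set x : 'I_(pred_arity R) -> (J -> T) |
  (forall i, uU (x i)) /\ W [set j | rel_of M R (fun i => x i j)]].
pose g f := [set p : ('I_(fun_arity f) -> (J -> T)) * (J -> T) |
  [/\ forall i, uU (p.1 i), uU p.2 & W [set j | graph_of M f (fun i => p.1 i j, p.2 j)]]].
have rsub R x : rl R x -> forall i, uU (x i) by case.
have gsub f x y : g f (x, y) -> (forall i, uU (x i)) /\ uU y by case.
have gtot f (x : 'I_(fun_arity f) -> _) : (forall i, uU (x i)) -> exists y, g f (x, y).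
  move=> ux.
  (* Values of functions are taken coordinatewise, with default [t0] where some argument lies
     outside [M]. This happens on a null set only, as there are finitely many arguments. *)
  have /choice[y yP] : forall j, exists y, (forall i, univ M (x i j)) ->
      graph_of M f (fun i => x i j, y).
    move=> j; have [h|nh] := pselect (forall i, univ M (x i j)); last by exists t0.
    by have [y gy] := graph_total h; exists y.
  have Wx : W [set j | forall i, univ M (x i j)].
    apply: WS (@complete_range_ord _ _ x (fun u => [set j | univ M (u j)]) _) => [j h i|].
      by apply: h; exists i.
    by move=> _ [i _ <-]; have [] := ux i.
  exists (r y); split=> //=.
    apply: r_uU; apply: WS Wx => j /yP gy.
    by have [] := graph_sub gy.
  by apply: WS (WI Wx (r_ae y)) => j [/yP gy e] /=; rewrite -e.
have gfun f x y y' : g f (x, y) -> g f (x, y') -> y = y'.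
  move=> [_ uy gy] [_ uy' gy']; apply: uU_eq => //.
  by apply: WS (WI gy gy') => j [/=]; exact: graph_fun.
exists (@Structure _ _ uU rl g rsub gsub gtot gfun); split=> //=.
- by move=> R x ux; split=> [[]|].
- by move=> f x y ux uy; split=> [[]|].
Qed.

Context (U : structure tau (J -> T)).
Hypothesis U_ultrapower : is_ultrapower U.

Let U_univ : univ U = uU. Proof. by case: U_ultrapower. Qed.

Let U_rel R x : (forall i, uU (x i)) ->
  (rel_of U R x <-> W [set j | rel_of M R (fun i => x i j)]).
Proof. by case: U_ultrapower => _ + _; exact. Qed.

Let U_graph f x y : (forall i, uU (x i)) -> uU y ->
  (graph_of U f (x, y) <-> W [set j | graph_of M f (fun i => x i j, y j)]).
Proof. by case: U_ultrapower => _ _; exact. Qed.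

Let ev j (u : J -> T) := u j.

(** The small submodels of [U] that almost all evaluations copy onto a strong submodel of [M]. [U]
    turns out to be their directed union. *)
Definition good (S : structure tau (J -> T)) := [/\ submodel S U, complete_for (univ S) &
  W [set j | exists2 Q, aec_le k Q M & isomorphism (ev j) S Q]].

(** By completeness for [B], its tuples and the symbols, almost every evaluation is injective on [B]
    and preserves all atomic relations at once. So it suffices that the universes match. *)
Let good_set B : B `<=` uU -> complete_for B ->
  W [set j | exists2 Q, aec_le k Q M & univ Q = ev j @` B] ->
  exists2 S, good S & univ S = B.
Proof.
move=> BU cB WB.
have [|S SU SB] := @fclosed_submodel _ _ U B.
  split; first by rewrite U_univ.
  move=> f x y Bx gxy; have [_ uy] := graph_sub gxy.
  rewrite U_univ in uy; have h := U_graph (fun i => BU _ (Bx i)) uy.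
  have [v Bv vy] : exists2 v, B v & W [set j | v j = y j].
    apply: W_some => //; apply: WS (WI WB (h.1 gxy)) => j [/= [Q QM QB] gM].
    have [_ clQ] := submodel_fclosed (aec_le_sub QM).
    have := clQ _ _ _ _ gM; rewrite QB => /(_ _)[i|v Bv <-]; last by exists v.
    by exists (x i).
  by rewrite -(uU_eq (BU _ Bv) uy).
exists S => //; split; rewrite ?SB //.
have Winj : W [set j | forall u, B u -> forall v, B v -> u j = v j -> u = v].
  apply: (cB (fun u => [set j | forall v, B v -> u j = v j -> u = v])) => u Bu.
  apply: (cB (fun v => [set j | u j = v j -> u = v])) => v Bv.
  have [->|uv] := pselect (u = v); first by apply: WS WT.
  have /W_not : ~ W [set j | u j = v j].
    by move=> e; apply: uv; apply: uU_eq e; exact: BU.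
  by apply: WS => j /= nuv /nuv.
have Wiff P (X : set J) : (P <-> W X) -> W [set j | P <-> X j].
  move=> PX; have [p|nP] := pselect P; first by apply: WS (PX.1 p) => j Xj; split.
  have /W_not : ~ W X by move=> /PX.
  by apply: WS => j nX; split.
have Wrel : W [set j | forall R, [set: pred_sym tau] R -> forall x, (forall i, B (x i)) ->
    (rel_of U R x <-> rel_of M R (fun i => x i j))].
  apply: (W_pred (X := fun R => [set j | forall x, (forall i, B (x i)) ->
    (rel_of U R x <-> rel_of M R (fun i => x i j))])) => R _.
  apply: (complete_tuples (X := fun x => [set j | rel_of U R x <-> rel_of M R (fun i => x i j)]) cB).
  by move=> x Bx; apply: Wiff; apply: U_rel => i; exact: BU.
have Wgraph : W [set j | forall f, [set: fun_sym tau] f -> forall x, (forall i, B (x i)) ->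
    forall y, B y -> (graph_of U f (x, y) <-> graph_of M f (fun i => x i j, y j))].
  apply: (W_fun (X := fun f => [set j | forall x, (forall i, B (x i)) ->
    forall y, B y -> (graph_of U f (x, y) <-> graph_of M f (fun i => x i j, y j))])) => f _.
  apply: (complete_tuples (X := fun x => [set j | forall y, B y ->
    (graph_of U f (x, y) <-> graph_of M f (fun i => x i j, y j))]) cB) => x Bx.
  apply: (cB (fun y => [set j | graph_of U f (x, y) <-> graph_of M f (fun i => x i j, y j)])).
  by move=> y By; apply: Wiff; apply: U_graph => [i|]; exact: BU.
apply: WS (WI (WI WB Winj) (WI Wrel Wgraph)) => j [[/= [Q QM QB] inj] [rl gr]].
have [_ Qr Qg] := aec_le_sub QM; have [_ Sr Sg] := SU.
exists Q => //; split.
- rewrite SB QB; split; [by move=> x Bx; exists x| |by []].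
  by apply/set_injP => u v Bu Bv; exact: (inj u Bu v Bv).
- move=> R x; rewrite SB => Bx; rewrite Sr ?SB // rl // Qr // => i.
  by rewrite QB; exists (x i).
- move=> f x y; rewrite SB => Bx By; rewrite Sg ?SB // gr // Qg // => [i|]; rewrite QB.
    by exists (x i).
  by exists y.
Qed.

(** Some coordinate evaluates both structures isomorphically onto strong submodels of [M]; there
    coherence applies, and the order is pulled back. *)
Let good_le S S' : good S -> good S' -> univ S `<=` univ S' -> aec_le k S S'.
Proof.
move=> [SU _ WS1] [S'U _ WS'] sub.
have [j [/= [Q QM iQ] [Q' Q'M iQ']]] := W_ex (WI WS1 WS').
have sSS' := submodel_sub SU S'U sub.
apply: (aec_le_iso_inv sSS' iQ iQ'); apply: aec_coherence QM Q'M.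
exact: submodel_isomorphism iQ iQ'.
Qed.

(** Each coordinate has a small strong submodel [N j] containing the values of [A] there. Functions
    enumerating all the [N j] simultaneously represent the elements of the required good
    structure. *)
Let good_cover A : A `<=` uU -> complete_for A -> exists2 S, good S & A `<=` univ S.
Proof.
move=> AU cA; pose Aj j := [set t | t = t0 \/ (univ M t /\ exists2 u, A u & u j = t)].
have /choice[N NP] : forall j, exists N, [/\ aec_le k N M, Aj j `<=` univ N &
    univ N #<= [set: (Aj j + L)%type]].
  by move=> j; apply: kL.2 => // t [->//|[]].
(* A single index type enumerating every [univ (N j)]: the [j]-th coordinates of
   the elements of [A], the point [t0], and [L]. *)
pose Y := (option A + L)%type.
have cY : complete_for [set: Y].
  by apply: complete_sum => //; apply: complete_option; exact: complete_set_type.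
have /choice[e eP] : forall j, exists e : Y -> T, (forall y, univ (N j) (e y)) /\
    (forall t, univ (N j) t -> exists y, e y = t).
  move=> j; have [NM AN NL] := NP j.
  have ALne : inhabited (Aj j + L) by exists; left; exists t0; apply/mem_set; left.
  have [p _ pI] := (card_le_fun _ _ ALne).1 NL.
  (* [m y t] says that [y] labels [t]: [p] injects [N j] into [Aj j] plus [L], and [y] names [p t].
     A label fits at most one [t]; labels that fit none may be sent to [t0]. *)
  pose m (y : Y) t := univ (N j) t /\ match y, p t with
    | inl o, inl a => (if o is Some u then val u j else t0) = val a
    | inr l, inr l' => l = l'
    | _, _ => False end.
  have mI y t t' : m y t -> m y t' -> t = t'.
    move=> [Nt mt] [Nt' mt']; apply: pI => //; move: mt mt'.
    case: y (p t) (p t') => [o|l] [a|l1] [a'|l2] //= e e'.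
      by congr inl; apply: val_inj; rewrite /= -e -e'.
    by rewrite -e -e'.
  have /choice[e eP] : forall y, exists t, univ (N j) t /\ ((exists t, m y t) -> m y t).
    move=> y; have [[t mt]|nt] := pselect (exists t, m y t).
      by exists t; split=> //; case: mt.
    by exists t0; split=> //; apply: AN; left.
  exists e; split=> [y|t Nt]; first by have [] := eP y.
  have [y my] : exists y, m y t.
    case pt : (p t) => [[a /= aA]|l]; last by exists (inr l); split=> //; rewrite pt.
    have [at0|[_ [u Au ua]]] := set_mem aA.
      by exists (inl None); split=> //; rewrite pt.
    by exists (inl (Some (SigSub (mem_set Au)))); split=> //; rewrite pt.
  by exists y; apply: (mI y _ _ _ my); apply: (eP y).2; exists t.
pose E y j := e j y.
pose B := range (fun y => r (E y)).
have BU : B `<=` uU.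
  move=> _ [y _ <-]; apply: r_uU; apply: WS WT => j _.
  have [NM _ _] := NP j; have [s _ _] := aec_le_sub NM; apply: s; exact: (eP j).1.
have Er : W [set j | forall y, [set: Y] y -> E y j = r (E y) j].
  by apply: (cY (fun y => [set j | E y j = r (E y) j])) => y _; exact: r_ae.
have [|||S gS SB] := @good_set B => //; first exact: complete_image.
  apply: WS Er => j Ej; exists (N j); first by have [] := NP j.
  apply/seteqP; split=> [t /(eP j).2[y <-]|_ [_ [y _ <-] <-]].
    by exists (r (E y)); [exists y|rewrite /ev -Ej].
  by rewrite /ev -Ej //; exact: (eP j).1.
exists S => //; rewrite SB => u Au; have [ru uM] := AU _ Au.
have [y _ yu] : exists2 y, [set: Y] y & W [set j | E y j = u j].
  apply: W_some => //; apply: WS uM => j uj.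
  have [_ AN _] := NP j; have [|y ey] := (eP j).2 (u j).
    by apply: AN; right; split=> //; exists u.
  by exists y.
by exists y => //; rewrite -ru; exact: r_eq.
Qed.

(** By [good_cover] the good structures are directed, and every tuple of [U], being finite, lies in
    one of them. *)
Theorem ultrapower_aec : aec_K k U /\ forall S, good S -> aec_le k S U.
Proof.
pose I := {S | good S}.
have cov A : A `<=` uU -> complete_for A -> exists S : I, A `<=` univ (sval S).
  by move=> AU /(good_cover AU)[S gS AS]; exists (exist _ S gS).
have sU (S : I) : univ (sval S) `<=` uU.
  by have [[s _ _] _ _] := svalP S; rewrite -U_univ.
have [|||KU leU _] := @aec_directed_union _ k _ I sval U.
- by have [S] := cov set0 (@sub0set _ _) (@complete_set0 _).
- move=> S S'; have [||S'' sub] := @cov (univ (sval S) `|` univ (sval S')) _ _.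
  + by move=> x [|]; exact: sU.
  + by have [_ c _] := svalP S; have [_ c' _] := svalP S'; exact: complete_setU.
  + exists S''; split; apply: good_le (svalP _) (svalP _) _ => x h;
    by apply: sub; solve [by left | by right].
- split.
  + apply/seteqP; split=> [x|x [S _ /sU]]; rewrite U_univ // => ux.
    have [|S h] := cov [set x] _ (@complete_set1 _ x); first by move=> _ ->.
    by exists S => //; exact: h.
  + move=> R; apply/seteqP; split=> [x rx|x [S _ rx]]; last first.
      by have [[_ sr _] _ _] := svalP S; apply/(sr _ _ (rel_sub rx)).
    have [|S h] := cov (range x) _ (@complete_range_ord _ _ x).
      by move=> _ [i _ <-]; rewrite -U_univ; exact: rel_sub rx i.
    exists S => //; have [[_ sr _] _ _] := svalP S.
    by apply/sr => // i; apply: h; exists i.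
  + move=> f; apply/seteqP; split=> [[x y] rx|[x y] [S _ rx]]; last first.
      by have [[_ _ sr] _ _] := svalP S; have [ux uy] := graph_sub rx; apply/(sr _ _ _ ux uy).
    have [ux uy] := graph_sub rx.
    have [||S h] := cov (range x `|` [set y]).
    * by rewrite -U_univ => z [[i _ <-]|->].
    * by apply: complete_setU; [exact: complete_range_ord|exact: complete_set1].
    exists S => //; have [[_ _ sr] _ _] := svalP S.
    by apply/sr => // [i|]; apply: h; [left; exists i|right].
by split=> // S gS; exact: (leU (exist _ S gS)).
Qed.

(** Each [f j] is defined on a part [Nj j] only, but a small strong submodel [E] of [N] lies in
    almost all parts. There the [f j] agree with [g], so [g] maps [E] onto a good structure. The
    image of [N] is the directed union of these. *)
Theorem ultrapower_embedding T1 (N : structure tau T1) (Nj : J -> structure tau T1)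
    (f : J -> T1 -> T) :
  aec_K k N -> (forall j, aec_le k (Nj j) N) -> (forall j, le_embedding k (f j) (Nj j) M) ->
  (forall x, univ N x -> W [set j | univ (Nj j) x]) ->
  le_embedding k (fun x => r (fun j => f j x)) N U.
Proof.
move=> KN NjN fP WN; set g := fun x => _.
have gae x : W [set j | f j x = g x j] by exact: r_ae.
have gU x : univ N x -> uU (g x).
  move=> /WN Wx; apply: r_uU; apply: WS Wx => j Nx.
  have [Q QM iQ] := fP j; have [s _ _] := aec_le_sub QM; apply: s.
  by rewrite (isomorphism_univ iQ); exists x.
pose I := {E | aec_le k E N /\ complete_for (univ E)}.
have imE E : aec_le k E N -> complete_for (univ E) ->
    exists2 S, good S & isomorphism g E S.
  move=> EN cE; have [sEN _ _] := aec_le_sub EN.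
  have Wf : W [set j | (forall x, univ E x -> f j x = g x j) /\
      exists2 Q, aec_le k Q M & isomorphism (f j) E Q].
    have h1 : W [set j | forall x, univ E x -> f j x = g x j].
      by apply: (cE (fun x => [set j | f j x = g x j])) => x _; exact: gae.
    have h2 : W [set j | forall x, univ E x -> univ (Nj j) x].
      by apply: (cE (fun x => [set j | univ (Nj j) x])) => x /sEN; exact: WN.
    apply: WS (WI h1 h2) => j [/= fg EN']; split=> //.
    have ENj : aec_le k E (Nj j).
      apply: (aec_coherence _ EN (NjN j)).
      exact: submodel_sub (aec_le_sub EN) (aec_le_sub (NjN j)) EN'.
    have [Q QM iQ] := le_embedding_sub ENj (fP j); by exists Q.
  have [|||S gS Su] := @good_set (g @` univ E).
  - by move=> _ [x /sEN ux <-]; exact: gU.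
  - exact: complete_image.
  - apply: WS Wf => j [fg [Q QM iQ]]; exists Q => //.
    rewrite (isomorphism_univ iQ); apply/seteqP; split=> [_ [x ux <-]|_ [_ [x ux <-] <-]].
      by exists (g x); [exists x|rewrite /ev fg].
    by exists x => //; rewrite fg.
  exists S => //; have [_ _ WS'] := gS.
  have [j [/= [fg [Q QM iQ]] [Q' Q'M iQ']]] := W_ex (WI Wf WS').
  (* The image of [E] under [f j] and the evaluation of [S] at [j] are submodels of [M] with the
     same universe. Hence [g] on [E] is [f j] followed by the inverse of the evaluation. *)
  have QQ' : Q = Q'.
    apply: submodel_eq (aec_le_sub QM) (aec_le_sub Q'M) _.
    rewrite (isomorphism_univ iQ) (isomorphism_univ iQ') Su.
    apply/seteqP; split=> [_ [x ux <-]|_ [_ [x ux <-] <-]].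
      by exists (g x); [exists x|rewrite /ev fg].
    by exists x => //; rewrite fg.
  have [h [ih hev _]] := isomorphism_inverse (inhabits (fun=> t0)) iQ'.
  rewrite -QQ' in ih; have := isomorphism_comp iQ ih; apply: isomorphism_eq_on => x ux /=.
  by rewrite fg // (hev (g x)) // Su; exists x.
have gI : set_inj (univ N) g.
  apply/set_injP => x y ux uy gxy.
  have [|||E [EN AE cE]] := @LST_complete _ N [set x; y] => //.
  - by move=> _ [->|->].
  - by apply: complete_setU; exact: complete_set1.
  have [S _ [[_ /set_injP inj _] _ _]] := imE E EN cE.
  by apply: inj gxy; apply: AE; [left|right].
have [N' N'u iN'] := image_structure gI; exists N' => //.
have /choice[S SP] : forall E : I, exists S, good S /\ isomorphism g (sval E) S.
  by move=> [E [EN cE]]; have [S] := imE E EN cE; exists S.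
have cov A : A `<=` univ N -> complete_for A -> exists E : I, A `<=` univ (sval E).
  by move=> AN /(LST_complete KN AN)[E [EN AE cE]]; exists (exist _ E (conj EN cE)).
have SN' (E : I) : submodel (S E) N'.
  have [[EN _] [_ iS]] := (svalP E, SP E).
  exact: submodel_isomorphism (aec_le_sub EN) iS iN'.
have [|||_ _ leP] := @aec_directed_union _ k _ I S N'.
- by have [E] := cov set0 (@sub0set _ _) (@complete_set0 _).
- move=> E E'; have [||E'' sub] := @cov (univ (sval E) `|` univ (sval E')) _ _.
  + have [[/aec_le_sub[s _ _] _] [/aec_le_sub[s' _ _] _]] := (svalP E, svalP E').
    by move=> x [|]; [exact: s|exact: s'].
  + by have [[_ c] [_ c']] := (svalP E, svalP E'); exact: complete_setU.
  + have [gS iS] := SP E; have [gS' iS'] := SP E'.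
    exists E''; have [gS'' iS''] := SP E''.
    split; apply: good_le => //; rewrite (isomorphism_univ iS'')
      ?(isomorphism_univ iS) ?(isomorphism_univ iS') => _ [x ux <-];
    by exists x => //; apply: sub; solve [by left | by right].
- have lift E x : univ (sval E) x -> univ (S E) (g x).
    by move=> ux; have [_ iS] := SP E; rewrite (isomorphism_univ iS); exists x.
  split.
  + apply/seteqP; split=> [y|y [E _ Sy]]; last by have [s _ _] := SN' E; exact: s.
    rewrite N'u => -[x ux <-].
    have [|E h] := cov [set x] _ (@complete_set1 _ x); first by move=> _ ->.
    by exists E => //; apply: lift; exact: h.
  + move=> R; apply/seteqP; split=> [y ry|y [E _ ry]]; last first.
      by have [_ sr _] := SN' E; apply/(sr _ _ (rel_sub ry)).
    have [x ux yx] := isomorphism_lift iN' (rel_sub ry); subst y.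
    have [|E h] := cov (range x) _ (@complete_range_ord _ _ x); first by move=> _ [i _ <-].
    exists E => //; have [_ sr _] := SN' E.
    by apply/sr => // i; apply: lift; apply: h; exists i.
  + move=> f'; apply/seteqP; split=> [[y z] ry|[y z] [E _ ry]]; last first.
      by have [_ _ sr] := SN' E; have [ux uy] := graph_sub ry; apply/(sr _ _ _ ux uy).
    have [uy] := graph_sub ry; rewrite N'u => -[w uw wz]; subst z.
    have [x ux yx] := isomorphism_lift iN' uy; subst y.
    have [||E h] := cov (range x `|` [set w]).
    * by move=> z [[i _ <-]|->].
    * by apply: complete_setU; [exact: complete_range_ord|exact: complete_set1].
    exists E => //; have [_ _ sr] := SN' E.
    by apply/sr => // [i|]; apply: lift; apply: h; [left; exists i|right].
by apply: leP => E; apply: ultrapower_aec.2; exact: (SP E).1.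
Qed.
End ultrapower.
End ultrafilter_on_index.

(** * Strong limit cardinals *)
Lemma card_leTT X Y : [set: X] #<= [set: Y] <-> exists f : X -> Y, injective f.
Proof.
split=> [/card_le_set_type[f fI]|[f fI]].
  exists (fun x => val (f (SigSub (mem_set (Logic.I : [set: X] x))))).
  by move=> x y /val_inj/fI/(congr1 val).
apply/card_le_set_type; exists (fun x => SigSub (mem_set (Logic.I : [set: Y] (f (val x))))).
by move=> x y /(congr1 val)/fI/val_inj.
Qed.

(** By recursion along [R], each element of [V] takes a point of [Z] not taken by earlier ones.
    Either this never fails and [V] injects into [Z], or it first fails at some [a], and then the
    elements before [a] have used up [Z]. *)
Lemma greedy_enumeration W T (R : W -> W -> Prop) (V : set W) (Z : set T) :
  well_founded R -> (forall x y, x <> y -> R x y \/ R y x) -> inhabited T ->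
  V #<= Z \/ exists2 a, V a & exists f, set_bij [set y | V y /\ R y a] Z f.
Proof.
move=> wfR tri T0.
pose free (y : W) (rec : forall y', R y' y -> option T) z :=
  Z z /\ forall y' (h : R y' y), V y' -> rec y' h <> Some z.
pose step (y : W) rec : option T :=
  if pselect (exists z, @free y rec z) is left h then Some (projT1 (cid h)) else None.
pose F := Fix wfR (fun=> option T) step.
have FE y : F y = step y (fun y' _ => F y').
  rewrite /F Fix_eq // => x f g fg; congr step.
  apply: functional_extensionality_dep => z; apply: functional_extensionality_dep => h.
  exact: fg.
have FS y z : F y = Some z -> Z z /\ forall y', R y' y -> V y' -> F y' <> Some z.
  rewrite FE /step; case: pselect => // h [<-]; exact: projT2 (cid h).
have FN y : F y = None -> Z `<=` [set z | exists2 y', V y' & R y' y /\ F y' = Some z].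
  rewrite FE /step; case: pselect => // h _ z Zz; apply: contrapT => nz.
  by apply: h; exists z; split=> // y' Ry Vy e; apply: nz; exists y'.
have [t0] := T0; pose f y := odflt t0 (F y).
have inj y y' : V y -> V y' -> F y <> None -> F y' <> None -> f y = f y' -> y = y'.
  rewrite /f => Vy Vy'; case Fy: (F y) => [z|//] _; case Fy': (F y') => [z'|//] _ /= zz'.
  apply: contrapT => /tri[|] Ry.
    by have [_ /(_ _ Ry Vy)] := FS _ _ Fy'; rewrite Fy zz'.
  by have [_ /(_ _ Ry Vy')] := FS _ _ Fy; rewrite Fy' zz'.
have fZ y : F y <> None -> Z (f y).
  by rewrite /f; case Fy: (F y) => [z|//] _; have [] := FS _ _ Fy.
have [[a0 [Va0 Fa0]]|nF] := pselect (exists a, V a /\ F a = None); last first.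
  left; apply/card_le_fun => //; exists f => [y Vy|x y Vx Vy]; [apply: fZ|apply: inj => //];
  by move=> Fn; apply: nF; eexists; split; last exact: Fn.
right; have [a [Va Fa] amin] : exists2 a, V a /\ F a = None &
    forall y, V y -> R y a -> F y <> None.
  apply: contrapT => na; suff: forall a, V a -> F a <> None by move/(_ _ Va0 Fa0).
  apply: (well_founded_ind wfR) => a IH Va Fa; apply: na; exists a => // y Vy Rya.
  exact: IH.
exists a => //; exists f; split.
- by move=> y [Vy Rya]; apply: fZ; exact: amin.
- by apply/set_injP => x y [Vx Rx] [Vy Ry]; apply: inj => //; exact: amin.
- by move=> z /(FN _ Fa)[y Vy [Ry Fy]]; exists y => //; rewrite /f Fy.
Qed.

Section strong_limit_cardinal.
Context d (mu : orderType d).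
Hypothesis mu_sl : strong_limit mu.

Definition small (X : Type) := card_lt [set: X] [set: mu].

Let mu_wf : wf_order mu.
Proof. by case: mu_sl => -[]. Qed.

Let mu_inh : inhabited mu.
Proof. by case: mu_sl => _ /card_leTT[f _] _; exists; exact: f 0. Qed.

Lemma small_inj X Y (f : X -> Y) : injective f -> small Y -> small X.
Proof.
by move=> fI sY muX; apply: sY; apply: card_le_trans muX _; apply/card_leTT; exists f.
Qed.

Lemma small_below (a : mu) : small (below a).
Proof.
case: mu_sl => -[_ h] _ _ /card_leTT[f fI]; apply: (h a).
apply/card_le_fun => //; exists (fun x => val (f x)) => [x _|x y _ _ /val_inj/fI//].
exact: valP (f x).
Qed.

(** Enumerating [X] along [mu] must stop at some [a], as otherwise [mu] would inject into [X]. *)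
Lemma small_bound X : small X -> exists a : mu, exists f : X -> below a, injective f.
Proof.
move=> sX; have [[x0]|nX] := pselect (inhabited X); last first.
  have [a0] := mu_inh; exists a0, (fun x => match nX (inhabits x) with end).
  by move=> x; exfalso; apply: nX.
have tri (x y : mu) : x <> y -> x < y \/ y < x.
  by move=> /eqP; rewrite neq_lt => /orP.
have [h|[a _ [f [fX /set_injP fI fS]]]] :=
  greedy_enumeration setT [set: X] mu_wf tri (inhabits x0).
  by exfalso; apply: sX; exact: h.
have /choice[g gP] : forall x, exists y : below a, f (val y) = x.
  by move=> x; have [y [_ ya] <-] := fS x Logic.I; exists (exist _ y ya).
by exists a, g => x y e; rewrite -(gP x) e gP.
Qed.

Lemma small_le X : small X -> [set: X] #<= [set: mu].
Proof.
move=> /small_bound[a [f fI]]; apply/card_leTT; exists (fun x => val (f x)).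
by move=> x y /val_inj/fI.
Qed.

Lemma small_set X : small X -> small (set X).
Proof.
move=> /small_bound[a [f fI]] h; case: mu_sl => -[_ ca] _ pw.
apply: (pw [set y | y < a] (ca a)); apply: card_le_trans h _.
apply/card_le_fun; first by exists; exact: set0.
exists (fun A => [set val (f x) | x in A]) => [A _ _ [x _ <-]|A B _ _ e].
  exact: valP (f x).
have sub (A' B' : set X) : [set val (f x) | x in A'] = [set val (f x) | x in B'] -> A' `<=` B'.
  move=> e' x Ax; have : [set val (f x) | x in A'] (val (f x)) by exists x.
  by rewrite e' => -[y By /val_inj/fI <-].
by apply/seteqP; split; exact: sub.
Qed.

Lemma small_option X : small X -> small (option X).
Proof.
move=> /small_set; apply: (small_inj (f := fun o => [set x | o = Some x])).
move=> [x|] [y|] // e.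
- by have : [set z | Some x = Some z] x by []; rewrite e => ->.
- by have : [set z | Some x = Some z] x by []; rewrite e.
- by have : [set z | Some y = Some z] y by []; rewrite -e.
Qed.

(** Kuratowski pairs inject the square into the double power set, which is small as [mu] is a strong
    limit. *)
Let small_square X : small X -> small (X * X).
Proof.
move=> /small_set/small_set; apply: (small_inj (f := fun p => [set [set p.1]; [set p.1; p.2]])).
move=> [u v] [u' v'] /= e.
have uu' : u = u'.
  have : [set [set u]; [set u; v]] [set u] by left.
  by rewrite e => -[] h; [have : [set u] u' by rewrite h|have : [set u] u' by rewrite h; left].
subst u'; congr pair.
have h1 : [set [set u]; [set u; v']] [set u; v] by rewrite -e; right.
have h2 : [set [set u]; [set u; v]] [set u; v'] by rewrite e; right.
have vv' : [set u; v] v by right.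
have vv'' : [set u; v'] v' by right.
have vE : v = u \/ v = v'.
  by case: h1 => h1; rewrite h1 in vv'; [left; exact: vv'|exact: vv'].
have v'E : v' = u \/ v' = v.
  by case: h2 => h2; rewrite h2 in vv''; [left; exact: vv''|exact: vv''].
by case: vE => // vu; case: v'E => ->.
Qed.

Lemma small_prod X Y : small X -> small Y -> small (X * Y).
Proof.
move=> /small_bound[a [f fI]] /small_bound[b [g gI]].
have fa x : val (f x) < Order.max a b.
  by apply: lt_le_trans (valP (f x)) _; rewrite le_max lexx.
have gb x : val (g x) < Order.max a b.
  by apply: lt_le_trans (valP (g x)) _; rewrite le_max lexx orbT.
pose h (p : X * Y) : below (Order.max a b) * below (Order.max a b) :=
  (Sub (val (f p.1)) (fa p.1), Sub (val (g p.2)) (gb p.2)).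
apply: (small_inj (f := h)); last exact/small_square/small_below.
by move=> [x y] [x' y'] [/val_inj/fI -> /val_inj/gI ->].
Qed.

(* The pairs are ordered by their maximum first, so that initial segments are
   contained in squares of proper initial segments of [mu]. *)
Lemma mu_square : [set: mu * mu] #<= [set: mu].
Proof.
have [r] := wo_rel_exists (mu * mu).
pose m (p : mu * mu) := Order.max p.1 p.2.
pose R p q := m p < m q \/ m p = m q /\ (r p q /\ p <> q).
have wfR : well_founded R.
  move=> p; apply: contrapT => np.
  have [_ [p1 np1 <-] pm] := wf_order_min mu_wf
    (ex_intro [set m p | p in [set p | ~ Acc R p]] (m p) (ex_intro2 _ _ p np erefl)).
  have [q [nq mq] qm] := @wo_min _ r [set q | ~ Acc R q /\ m q = m p1] (ex_intro _ p1 (conj np1 erefl)).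
  apply: nq; constructor => q' [lt|[e [rq nqq]]]; apply: contrapT => nq'.
    have : m p1 <= m q' by apply: pm; exists q'.
    by rewrite leNgt -mq lt.
  apply: nqq; apply: (@wo_anti _ r); rewrite rq qm //; split=> //; exact: etrans e mq.
have tri p q : p <> q -> R p q \/ R q p.
  move=> pq; case: (ltgtP (m p) (m q)) => e; [by left; left|by right; left|].
  have /orP[|] := @wo_total _ r p q => h; [left|right]; right; split=> //.
  by split=> //; exact: nesym.
have [//|[q _ [f [fM /set_injP fI fS]]]] :=
  @greedy_enumeration (mu * mu) mu R setT setT wfR tri mu_inh.
(* If [mu] is used up before the pair [q], it injects into the pairs before [q], whose entries are
   at most [m q]. *)
exfalso; have : small (option (below (m q)) * option (below (m q))).
  by apply: small_prod; apply: small_option; exact: small_below.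
apply; have /choice[g gP] : forall z, exists p, R p q /\ f p = z.
  by move=> z; have [p [_ Rp] <-] := fS z Logic.I; exists p.
(* The extra value [None] encodes [m q] itself, which [below (m q)] leaves out. *)
pose c (x : mu) : option (below (m q)) := insub x.
have cI x y : x <= m q -> y <= m q -> c x = c y -> x = y.
  rewrite /c le_eqVlt => /orP[/eqP->|xq].
    rewrite insubF ?ltxx // le_eqVlt => /orP[/eqP->//|yq].
    by case: insubP => //; rewrite yq.
  rewrite le_eqVlt => /orP[/eqP->|yq].
    by rewrite [RHS]insubF ?ltxx //; case: insubP => //; rewrite xq.
  by case: insubP => [u _ <-|]; rewrite ?xq //; case: insubP => [v _ <-|]; rewrite ?yq // => -[->].
apply/card_leTT; exists (fun z => (c (g z).1, c (g z).2)) => z z' [e1 e2].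
have mR p : R p q -> p.1 <= m q /\ p.2 <= m q.
  move=> h; have : m p <= m q by case: h => [/ltW//|[->]].
  by rewrite /m ge_max => /andP.
have [[a1 b1] [a2 b2]] := (mR _ (gP z).1, mR _ (gP z').1).
rewrite -(gP z).2 -(gP z').2; congr f.
move: (cI _ _ a1 a2 e1) (cI _ _ b1 b2 e2).
by case: (g z) (g z') => [? ?] [? ?] /= -> ->.
Qed.

Lemma small_sigma (Z : mu -> Type) : (forall a, small (Z a)) ->
  [set: {a & Z a}] #<= [set: mu].
Proof.
move=> sZ; have h a : exists i : (Z a -> mu), injective i.
  by apply/card_leTT; exact: small_le.
pose i a := projT1 (cid (h a)); have iP a : injective (i a) := projT2 (cid (h a)).
apply: card_le_trans mu_square; apply/card_leTT; exists (fun x => (tag x, i (tag x) (tagged x))).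
by move=> [a x] [b y] [/= ab]; subst b => /iP ->.
Qed.

(** A tuple of any arity is coded by its graph, a set of pairs of a number and a point. Relations
    and functions then become sets over one small type. *)
Lemma small_structure tau X : small (pred_sym tau) -> small (fun_sym tau) -> small nat ->
  small X -> small (structure tau X).
Proof.
move=> sp sf sn sX; pose N := set (nat * X).
have sN : small N by apply: small_set; exact: small_prod.
pose code n (x : 'I_n -> X) : N := [set p | exists i : 'I_n, p = (val i, x i)].
have codeI n : injective (@code n).
  move=> x y e; apply/funext => i; have : code n x (val i, x i) by exists i.
  by rewrite e => -[j [/val_inj <-]].
pose rel_code (M : structure tau X) : set (pred_sym tau * N) :=
  [set p | exists2 x, rel_of M p.1 x & p.2 = code _ x].
pose graph_code (M : structure tau X) : set (fun_sym tau * N * X) :=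
  [set p | exists2 x, graph_of M p.1.1 (x, p.2) & p.1.2 = code _ x].
apply: (small_inj (f := fun M => (univ M, rel_code M, graph_code M))); last first.
  by apply: small_prod; [apply: small_prod => //|]; apply: small_set;
     [|apply: small_prod|apply: small_prod => //; apply: small_prod].
move=> M M' [eu er eg]; apply: structure_eq => //.
- have sub A B R : rel_code A = rel_code B -> rel_of A R `<=` rel_of B R.
    move=> e x Ax; have : rel_code A (R, code _ x) by exists x.
    by rewrite e => -[y /= By /codeI ->].
  by apply: functional_extensionality_dep => R; apply/seteqP; split; exact: sub.
- have sub A B f : graph_code A = graph_code B -> graph_of A f `<=` graph_of B f.
    move=> e [x y] Ax; have : graph_code A (f, code _ x, y) by exists x.
    by rewrite e => -[z /= By /codeI ->].
  by apply: functional_extensionality_dep => f; apply/seteqP; split; exact: sub.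
Qed.

End strong_limit_cardinal.

(** * Saturated ordinal models *)
Section measurable.
Context d (kappa : orderType d) (D : set (set kappa)).
Hypothesis kappa_card : is_cardinal kappa.
Hypothesis D_ultra : UltraFilter D.
Hypothesis D_nonprincipal : forall x, ~ D [set x].
Hypothesis D_complete : forall S : set (set kappa), card_lt S [set: kappa] ->
  S `<=` D -> D (\bigcap_(X in S) X).

Lemma measure_mono A B : A `<=` B -> D A -> D B.
Proof. exact: filterS. Qed.

Lemma measure_complete T (A : set T) : card_lt A [set: kappa] -> complete_for D A.
Proof.
move=> cA X DX; have := @D_complete (X @` A) _ _.
set P := D _; suff: P -> D [set j | forall x, A x -> X x j].
  move=> h h'; apply: h; apply: h' => [h|_ [x Ax <-]]; last exact: DX.
  by apply: cA; apply: card_le_trans h (card_image_le _ _).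
by apply: measure_mono => j h x Ax; apply: h; exists x.
Qed.

(** The complement consists of [b] and the fewer than [kappa] points below it, each of measure
    zero. *)
Lemma measure_tail b : D [set x | b < x].
Proof.
have Dn x : D (~` [set x]).
  by case: (in_ultra_setVsetC [set x] D_ultra) => // /D_nonprincipal.
have := measure_complete (kappa_card.2 b) (fun x _ => Dn x).
move=> /(filterI (Dn b)); apply: measure_mono => x [/= xb h].
rewrite ltNge le_eqVlt; apply/negP => /orP[/eqP//|xlt]; exact: h xlt _.
Qed.

(* The first coordinate chooses a model [M_(2i+1)] of the chain, the second one
   approximations to it and to [M1].  Keeping them apart makes it unnecessary to
   enumerate the models of the chain coherently. *)
Definition fubini : set (set (kappa * kappa)) := [set X | D [set i | D [set j | X (i, j)]]].

Lemma fubini_mono A B : A `<=` B -> fubini A -> fubini B.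
Proof.
by move=> AB; apply: measure_mono => i; apply: measure_mono => j; exact: AB.
Qed.

Lemma fubini_ultra A : fubini A \/ fubini (~` A).
Proof.
have [|h] := in_ultra_setVsetC [set i | D [set j | A (i, j)]] D_ultra; first by left.
right; apply: measure_mono h => i /= nD.
by have [|h] := in_ultra_setVsetC [set j | A (i, j)] D_ultra.
Qed.

Lemma fubini_neq0 : ~ fubini set0.
Proof.
by move=> h; have [i hi] := filter_ex (h : D _); have [j []] := filter_ex hi.
Qed.

Lemma fubini_complete T (A : set T) : card_lt A [set: kappa] -> complete_for fubini A.
Proof.
move=> cA X DX.
apply: measure_mono (measure_complete cA (X := fun x => [set i | D [set j | X x (i, j)]]) DX).
by move=> i /= h; exact: (measure_complete cA (X := fun x => [set j | X x (i, j)]) h).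
Qed.
End measurable.

(** * Doubling of ordinals, cofinal sequences and transport of structure *)

Lemma ord_succ_exists d (I : orderType d) (a b : I) : wf_order I -> a < b ->
  exists a', ord_succ a a'.
Proof.
move=> wfI ab; have [c ac cm] := wf_order_min wfI (ex_intro [set c | a < c] b ab).
by exists c.
Qed.

(** It makes the odd stages of a chain cofinal in it. *)
Lemma ord_double_ge d (I : orderType d) (dbl : I -> I) : wf_order I ->
  ord_double dbl -> forall a, a <= dbl a.
Proof.
move=> wfI [dbl0 dblS dblL]; apply: (well_founded_ind wfI) => a IH.
have [z|nz] := pselect (ord_zero a); first by rewrite dbl0.
have [[b ba bmax]|nb] := pselect (exists2 b, b < a & forall c, c < a -> c <= b).
  have ab : ord_succ b a.
    by split=> // c bc; rewrite leNgt; apply/negP => /bmax; rewrite leNgt bc.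
  have [c [bc _] [ca _]] := dblS _ _ ab.
  by apply: ab.2; apply: le_lt_trans (IH _ ba) _; exact: lt_trans bc ca.
have lima : ord_limit a.
  split=> // b ba; apply: contrapT => nc; apply: nb; exists b => // c ca.
  by rewrite leNgt; apply/negP => bc; apply: nc; exists c.
have [ub _] := dblL _ lima.
rewrite leNgt; apply/negP => /[dup] da /(lima.2)[c dc ca].
have : c <= dbl a by apply: le_trans (IH _ ca) _; apply: ub; exists c.
by rewrite leNgt dc.
Qed.

(** Let [f] number a cofinal set by [kappa]. Its elements with number below [e] are too few to be
    cofinal, and [m e] is a strict upper bound of them. *)
Lemma cofinality_sequence d (mu : orderType d) d' (kappa : orderType d') :
  inhabited kappa -> is_cofinality mu kappa ->
  exists m : kappa -> mu, forall z, exists b, forall e, b < e -> z < m e.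
Proof.
move=> k0 [kc [A Acof Ak] hmin].
have /(card_le_fun A setT k0)[f _ fI] : A #<= [set: kappa].
  by move: Ak; rewrite card_eq_le => /andP[].
have /choice[m mP] : forall e, exists x, forall y, A y -> f y < e -> y < x.
  move=> e; apply: contrapT => nx; apply: (kc.2 e).
  apply: card_le_trans (hmin [set y | A y /\ f y < e] _) _.
    move=> x; apply: contrapT => ny; apply: nx; exists x => y Ay fy.
    by rewrite ltNge; apply/negP => xy; apply: ny; exists y.
  apply/card_le_fun => //; exists f => [y []//|y z [Ay _] [Az _]]; exact: fI.
exists m => z; have [y Ay zy] := Acof z; exists (f y) => e fe.
exact: le_lt_trans zy (mP _ _ Ay fe).
Qed.

Lemma isomorphism_pullback tau T T' (g : T -> T') (A : set T) (N : structure tau T') :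
  inhabited T -> inhabited T' -> set_bij A (univ N) g ->
  exists2 M, univ M = A & isomorphism g M N.
Proof.
move=> [t0] T'0 [gA /set_injP gI gS].
have /choice[h hP] : forall y, exists x, univ N y -> A x /\ g x = y.
  by move=> y; have [/gS[x Ax gx]|] := pselect (univ N y); [exists x|exists t0].
have [|M uM iM] := @image_structure _ _ _ h N.
  by apply/set_injP => x y /hP[_ {2}<-] /hP[_ {2}<-] ->.
exists M.
  rewrite uM; apply/seteqP; split=> [_ [y /hP[Ax _] <-]//|x Ax].
  have [Ax' e] := hP _ (gA _ Ax); exists (g x); first exact: gA.
  exact: gI.
have [g' [ig' g'h _]] := isomorphism_inverse T'0 iM.
apply: isomorphism_eq_on ig' => x; rewrite uM => -[y uy <-].
by rewrite g'h // (hP _ uy).2.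
Qed.

(** * Extending and saturating ordinal models *)

Section ordinal_models.
Context tau (k : aec tau) d (mu : orderType d) dO (O : orderType dO).
Hypothesis mu_sl : strong_limit mu.
Hypothesis O_succ : is_succ_cardinal mu O.

Let mu_inh : inhabited mu.
Proof. by case: mu_sl => _ /card_leTT[f _] _; exists; exact: f 0. Qed.

Let O_wf : wf_order O.
Proof. by case: O_succ. Qed.

Local Notation omodel := (@ordinal_model tau k mu _ O).

Lemma omodel_card M : omodel M -> univ M #= [set: mu].
Proof.
move=> [_ [x -> le]]; rewrite card_eq_le le andbT.
by case: O_succ => _ _; exact.
Qed.

(** Otherwise [O] is the union of two sets of size at most that of [mu] and injects into [mu * mu],
    the first coordinate telling the two apart. *)
Let O_large (V : set O) (a : O) :
  V #<= [set: mu] -> (forall y, V y \/ y < a) -> False.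
Proof.
move=> /(card_le_fun _ _ mu_inh)[f _ fI] cov; have [_ nO seg] := O_succ; apply: nO.
have /(card_le_fun _ _ mu_inh)[g _ gI] := seg a.
have [m0] := mu_inh; have [z mz] : exists z : mu, m0 <> z.
  have [_ /card_leTT[h hI] _] := mu_sl.
  have [h0|] := pselect (h 0 = m0); last by move=> ?; exists (h 0) => ?; congruence.
  by exists (h 1); rewrite -h0 => /hI.
apply: card_le_trans (mu_square mu_sl); apply/card_leTT.
exists (fun y => if y < a then (m0, g y) else (z, f y)) => x y.
case: ifPn => xa; case: ifPn => ya [].
- exact: gI.
- by move=> /mz.
- by move=> /esym/mz.
have Vx : V x by case: (cov x) => //; rewrite (negbTE xa).
have Vy : V y by case: (cov y) => //; rewrite (negbTE ya).
exact: fI.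
Qed.

(** The elements of [N] outside the image of [M] are placed on the ordinals from [x] on. As [N] has
    size at most that of [mu], they run out at some [a] in [O]. *)
Lemma omodel_extension (M : structure tau O) T (N : structure tau T) (e : O -> T) :
  omodel M -> univ N #<= [set: mu] -> le_embedding k e M N ->
  exists M', [/\ omodel M', aec_le k M M' & exists2 g, isomorphism g M' N &
    forall y, univ M y -> g y = e y].
Proof.
move=> [KM [x Mx mx]] Nmu [Q QN iQ].
have T0 : inhabited T by exists; exact: e x.
have uQ := isomorphism_univ iQ; have [sQN _ _] := aec_le_sub QN.
have tri (y z : O) : y <> z -> y < z \/ z < y by move=> /eqP; rewrite neq_lt => /orP.
have [h|[a xa [f [fZ /set_injP fI fS]]]] :=
  greedy_enumeration [set y | x <= y] (univ N `\` univ Q) O_wf tri T0.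
  exfalso; apply: (@O_large [set y | x <= y] x); last by move=> y; case: (leP x y); [left|right].
  apply: card_le_trans h (card_le_trans (subset_card_le _) Nmu); exact: subDsetl.
have [[eM /set_injP eI eS] _ _] := iQ.
pose g y := if y < x then e y else f y.
have gM y : univ M y -> g y = e y by rewrite Mx /g => /= ->.
have [|M' uM' iM'] := @isomorphism_pullback _ _ _ g [set y | y < a] N (inhabits x) T0.
  split.
  - move=> y /= ya; rewrite /g; case: ifPn => [yx|]; last first.
      by rewrite -leNgt => xy; have [] := fZ y (conj xy ya).
    by apply: sQN; apply: eM; rewrite Mx.
  - apply/set_injP => y z /= ya za; rewrite /g; case: ifPn => yx; case: ifPn => zx.
    + by apply: eI; rewrite Mx.
    + move=> eq; have [_] := fZ z (conj (etrans (leNgt _ _) zx) za).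
      by case; rewrite -eq; apply: eM; rewrite Mx.
    + move=> eq; have [_] := fZ y (conj (etrans (leNgt _ _) yx) ya).
      by case; rewrite eq; apply: eM; rewrite Mx.
    + by apply: fI; split=> //; rewrite /= leNgt.
  - move=> t Nt; have [|nQt] := pselect (univ Q t).
      rewrite uQ => -[y uy <-]; exists y; last exact: gM.
      by rewrite Mx in uy; exact: lt_le_trans uy xa.
    have [y [xy ya] <-] := fS t (conj Nt nQt); exists y => //.
    by rewrite /g ltNge (xy : x <= y).
have [h [ih hg gh]] := isomorphism_inverse (inhabits x) iM'.
have [h' [ih' h'e eh']] := isomorphism_inverse (inhabits x) iQ.
exists M'; split.
- split; first by have [_ KN] := aec_le_K QN; apply/(aec_K_iso k iM').
  exists a => //; apply: card_le_trans mx (subset_card_le _) => y yx.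
  exact: lt_le_trans yx xa.
- apply: aec_le_iso ih QN; apply: isomorphism_eq_on ih' => y.
  rewrite uQ => -[z uz <-]; rewrite h'e // -gM // hg // uM' /=.
  by rewrite Mx in uz; exact: lt_le_trans uz xa.
- by exists g.
Qed.

(** Zorn's lemma for the preorder [R] below. An extension of a maximal model with a different set
    [S] is above it in [R], hence also below it, so it adds nothing to [S]. *)
Lemma omodel_saturation (Theta : Type) (S : structure tau O -> set Theta) M :
  [set: Theta] #<= [set: mu] ->
  (forall N N', omodel N -> omodel N' -> aec_le k N N' -> S N `<=` S N') ->
  omodel M -> exists M', [/\ omodel M', aec_le k M M' &
    forall N, omodel N -> aec_le k M' N -> S N `<=` S M'].
Proof.
move=> Thmu Smono oM; have KM := oM.1.
pose X := {N | omodel N /\ aec_le k M N}.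
pose v (t : X) : structure tau O := sval t.
have ov t : omodel (v t) := (svalP t).1.
(* Along a chain without last element the sets [S] strictly increase, so it is
   cofinal in [mu] many of its terms and its union is not all of [O]. *)
pose R (s t : X) := aec_le k (v s) (v t) /\ (s = t \/ S (v s) <> S (v t)).
have Rxx t : `[< R t t >].
  by apply/asboolP; split; [apply: aec_le_refl; exact: (ov t).1|left].
have Rtr s t u : `[< R s t >] -> `[< R t u >] -> `[< R s u >].
  move=> /asboolP[st h] /asboolP[tu h']; apply/asboolP; split; first exact: aec_le_trans tu.
  case: h => [->//|nst]; right=> su; apply: nst; apply/seteqP; split.
    exact: Smono.
  by rewrite su; exact: Smono.
have [||t tmax] := @ZL_preorder X (exist _ M (conj oM (aec_le_refl KM))) (fun s t => `[< R s t >]) Rxx.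
- by move=> s t u; exact: Rtr.
- move=> A Atot.
  have [[t [At tub]]|nmax] := pselect (exists t, A t /\ forall s, A s -> `[< R s t >]).
    by exists t.
  have [[a0 Aa0]|A0] := pselect (A !=set0); last first.
    exists (exist _ M (conj oM (aec_le_refl KM))) => s As; exfalso; apply: A0; by exists s.
  pose I := {t | A t}.
  have tot (i j : I) : R (sval i) (sval j) \/ R (sval j) (sval i).
    by case: (Atot _ _ (svalP i) (svalP j)) => /asboolP; [left|right].
  have next (i : I) : exists j : I, aec_le k (v (sval i)) (v (sval j)) /\
      exists2 th, S (v (sval j)) th & ~ S (v (sval i)) th.
    apply: contrapT => ni; apply: nmax; exists (sval i); split; first exact: svalP i.
    move=> s As; apply/asboolP; case: (tot (exist _ s As) i) => // -[/= le [e|ne]].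
      by rewrite -e; apply/asboolP.
    exfalso; apply: ni; exists (exist _ s As); split=> //=; apply: contrapT => nth.
    apply: ne; apply/seteqP; split; first exact: Smono.
    by move=> th Sth; apply: contrapT => nSth; apply: nth; exists th.
  have dir (i j : I) : exists l : I, aec_le k (v (sval i)) (v (sval l)) /\ aec_le k (v (sval j)) (v (sval l)).
    by case: (tot i j) => -[le _]; [exists j|exists i]; split=> //; apply: aec_le_refl; exact: (ov _).1.
  pose i0 : I := exist _ a0 Aa0.
  have [||N unN _] := @directed_union_exists tau O I setT (fun i => v (sval i)).
  + by exists i0.
  + by move=> i j _ _; have [l [il jl]] := dir i j; exists l; split=> //;
      [exact: aec_le_sub il|exact: aec_le_sub jl].
  have [KN leN _] := aec_directed_union (inhabits i0) dir unN.
  have [uN _ _] := unN.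
  have [o nNo] : exists o, ~ univ N o.
    apply: contrapT => no.
    (* [c th] picks a member of the chain with [th] in its set, if any has it. A point in member [i]
       also lies in [c th] for the value [th] new at the next step, since [c th] cannot be below
       [i]. So [mu] many models of size [mu] would cover [O]. *)
    have /choice[c cP] : forall th, exists i : I, (exists j : I, S (v (sval j)) th) -> S (v (sval i)) th.
      move=> th; have [[j Sj]|nj] := pselect (exists j : I, S (v (sval j)) th); first by exists j.
      by exists i0.
    have cof o : exists th, univ (v (sval (c th))) o.
      have : univ N o by apply: contrapT => nNo; apply: no; exists o.
      rewrite uN => -[i _ uo]; have [j [_ [th Sj nSi]]] := next i; exists th.
      have Sc : S (v (sval (c th))) th by apply: cP; exists j.
      case: (tot i (c th)) => -[le _]; first by have [s _ _] := aec_le_sub le; exact: s.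
      by exfalso; apply: nSi; exact: Smono le _ Sc.
    have /choice[th thP] := cof.
    have /choice[b bP] : forall i : I, exists f : O -> mu,
        forall x y, univ (v (sval i)) x -> univ (v (sval i)) y -> f x = f y -> x = y.
      move=> i; have := omodel_card (ov (sval i)); rewrite card_eq_le => /andP[].
      by move=> /(card_le_fun _ _ mu_inh)[f _ fI] _; exists f.
    have /card_leTT[q qI] := Thmu.
    have [_ nO _] := O_succ; apply: nO; apply: card_le_trans (mu_square mu_sl).
    apply/card_leTT; exists (fun o => (q (th o), b (c (th o)) o)) => x y [/qI e].
    by rewrite e; apply: bP; [rewrite -e; exact: thP|exact: thP].
  (* A union of initial segments is one, and the least point outside [N] is its end. *)
  have [x nNx xmin] := wf_order_min O_wf (ex_intro [set o | ~ univ N o] o nNo).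
  have Nx : univ N = [set y | y < x].
    apply/seteqP; split=> y; last first.
      by move=> /= yx; apply: contrapT => /xmin; rewrite leNgt yx.
    rewrite uN => -[i _ uy] /=; rewrite ltNge; apply/negP => xy; apply: nNx.
    rewrite uN; exists i => //; have [_ [z uz _]] := ov (sval i).
    by move: uy; rewrite uz; exact: le_lt_trans.
  have oN : omodel N.
    split=> //; exists x => //; rewrite -Nx; have [_ [z uz mz]] := ov (sval i0).
    apply: card_le_trans mz _; rewrite -uz; apply: subset_card_le.
    by have [s _ _] := aec_le_sub (leN i0).
  have MN : aec_le k M N by apply: aec_le_trans (leN i0); exact: (svalP a0).2.
  exists (exist _ N (conj oN MN)) => s As; apply/asboolP; split; first exact: (leN (exist _ s As)).
  right=> /= e; have [j [le [th Sj nSi]]] := next (exist _ s As).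
  by apply: nSi; rewrite /= e; apply: Smono Sj => //; exact: leN.
exists (v t); split=> //; first exact: (svalP t).2.
move=> N oN tN; have MN : aec_le k M N by apply: aec_le_trans tN; exact: (svalP t).2.
have [-> //|ne] := pselect (S (v t) = S N).
have /tmax/asboolP[/= Nt _] : `[< R t (exist _ N (conj oN MN)) >].
  by apply/asboolP; split=> //; right.
exact: Smono.
Qed.

(* A model [N] on an initial segment of [mu] and a set of pairs [(z, w)], each
   prescribing for [z] in [N] the element with index [w] in an enumeration [b]. *)
Definition task := {a : mu & (structure tau (below a) * set (below a * below a))%type}.

(** [M] supplies the prescribed values and [N] the room for the embedding. Being realized is thus
    preserved when [N] grows and [M] stays fixed. *)
Definition realized (M : structure tau O) (b : O -> mu) (N : structure tau O) : set task :=
  fun t => exists2 g : below (tag t) -> O, le_embedding k g (tagged t).1 N &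
    forall z w y, (tagged t).2 (z, w) -> univ M y -> b y = val w -> g z = y.

Lemma task_card : small mu (pred_sym tau) -> small mu (fun_sym tau) -> small mu nat ->
  [set: task] #<= [set: mu].
Proof.
move=> sp sf sn; apply: small_sigma => // a.
apply: small_prod => //; first by apply: small_structure => //; exact: small_below.
by apply: small_set => //; apply: small_prod => //; exact: small_below.
Qed.

(** The pair consists of the saturated extension and the enumeration of [M] by which the tasks over
    [M] are read. *)
Lemma omodel_task_saturation M :
  small mu (pred_sym tau) -> small mu (fun_sym tau) -> small mu nat -> omodel M ->
  exists p : structure tau O * (O -> mu), [/\ omodel p.1, aec_le k M p.1,
    forall x y, univ M x -> univ M y -> p.2 x = p.2 y -> x = y &
    forall N, omodel N -> aec_le k p.1 N -> realized M p.2 N `<=` realized M p.2 p.1].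
Proof.
move=> sp sf sn oM.
have := omodel_card oM; rewrite card_eq_le => /andP[/(card_le_fun _ _ mu_inh)[b _ bI] _].
have [|M' [oM' MM' sat]] := @omodel_saturation task (realized M b) M (task_card sp sf sn) _ oM.
  by move=> N N' _ _ le t [g gN gP]; exists g => //; exact: le_embedding_le le.
by exists (M', b).
Qed.
End ordinal_models.

(** * Amalgamation *)
Lemma small_lt_cofinality d (mu : orderType d) d' (kappa : orderType d') X :
  is_cofinality mu kappa -> card_lt [set: X] [set: kappa] -> small mu X.
Proof.
move=> [_ [A _ Ak] _] hX muX; apply: hX; apply: card_le_trans _ muX.
apply: card_le_trans _ (card_leT A).
by move: Ak; rewrite card_eq_le => /andP[].
Qed.

Lemma small_sum d (mu : orderType d) X Y :
  strong_limit mu -> small mu X -> small mu Y -> small mu (X + Y).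
Proof.
move=> sl /(small_option sl) sX /(small_option sl) sY.
pose f (s : X + Y) := match s with inl x => (Some x, None) | inr y => (None, Some y) end.
apply: (small_inj (f := f)); last exact: small_prod.
by move=> [x|y] [x'|y'] //= [->].
Qed.

(** The amalgam is the ultrapower of [M2]. The diagonal embeds [M2], and the classes of [e2 \o f j]
    embed [M1]. They agree on [M0] because almost all [f j] undo [e1] at a given point. *)
Lemma amalgamation_of_local_embeddings tau (k : aec tau) L J (W : set (set J))
    T0 T1 T2 (M0 : structure tau T0) (M1 : structure tau T1) (M2 : structure tau T2)
    (e1 : T0 -> T1) (e2 : T0 -> T2) (t2 : T2)
    (N : J -> structure tau T1) (f : J -> T1 -> T0) :
  LST_bound (@aec_K tau k) (@aec_le tau k) L ->
  (forall A B, A `<=` B -> W A -> W B) -> (forall A, W A \/ W (~` A)) -> ~ W set0 ->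
  complete_for W [set: nat] -> complete_for W [set: L] ->
  aec_K k M1 -> aec_K k M2 -> univ M2 t2 -> le_embedding k e2 M0 M2 ->
  (forall j, aec_le k (N j) M1) -> (forall j, le_embedding k (f j) (N j) M0) ->
  (forall x, univ M1 x -> W [set j | univ (N j) x]) ->
  (forall y, univ M0 y -> W [set j | f j (e1 y) = y]) ->
  exists T3 (M3 : structure tau T3) (e3 : T0 -> T3) (h1 : T1 -> T3) (h2 : T2 -> T3),
    [/\ le_embedding k e3 M0 M3, le_embedding k h1 M1 M3, le_embedding k h2 M2 M3,
        (forall x, univ M0 x -> h1 (e1 x) = e3 x) &
        (forall x, univ M0 x -> h2 (e2 x) = e3 x)].
Proof.
move=> kL WS WU W0 Wnat WL K1 K2 t2M e2M NM fM WN Wf.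
have [r [r_ae r_eq]] := ae_eq_repr WS WU W0 Wnat t2.
have [U hU] := ultrapower_exists WS WU W0 Wnat M2 t2 r_ae r_eq.
have emb := ultrapower_embedding WS WU W0 Wnat kL WL K2 t2M r_ae r_eq hU.
have h2 : le_embedding k (fun x => r (fun j => x)) M2 U.
  apply: (emb _ _ (fun=> M2) (fun=> id)) => //.
  - by move=> _; exact: aec_le_refl.
  - by move=> _; apply: aec_le_embedding; exact: aec_le_refl.
  - by move=> x ux; apply: WS (WL (fun=> setT) _) => // _ _; have [|] := WU setT; rewrite ?setCT.
exists (J -> T2), U, (fun y => r (fun j => e2 y)), (fun x => r (fun j => e2 (f j x))),
  (fun x => r (fun j => x)); split=> //.
- exact: le_embedding_comp e2M h2.
- by apply: (emb _ _ N (fun j => e2 \o f j)) => // j; exact: le_embedding_comp (fM j) e2M.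
- by move=> y uy; apply: r_eq; apply: WS (Wf y uy) => j /= ->.
Qed.

(** A copy of [N] on a segment of [mu], with the values of [g] in [M] of index below [c] prescribed,
    is a task. The restriction of [g] to [N] realizes it in [Mx], so it is realized in [FM] too. *)
Lemma local_embedding tau (k : aec tau) d (mu : orderType d) dO (O : orderType dO)
    (M FM Mx : structure tau O) (b : O -> mu) T (N N1 : structure tau T) (g : T -> O) (c : mu) :
  strong_limit mu -> univ N !=set0 -> small mu (univ N) ->
  (forall x y, univ M x -> univ M y -> b x = b y -> x = y) ->
  realized k M b Mx `<=` realized k M b FM ->
  aec_le k N N1 -> le_embedding k g N1 Mx ->
  exists f : T -> O, le_embedding k f N FM /\
    forall x, univ N x -> univ M (g x) -> b (g x) < c -> f x = g x.
Proof.
move=> sl [x0 Nx0] sN bI sat NN1 gN1.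
have [a0 [q0 q0I]] := small_bound sl sN.
(* One segment serves both as universe of the copy and as index set of the prescribed values, so it
   must contain [a0] and [c]. *)
pose a := Order.max a0 c.
have q0a x : val (q0 x) < a by apply: lt_le_trans (valP (q0 x)) _; rewrite le_max lexx.
have Na : univ N #<= [set: below a].
  apply: card_le_trans (_ : univ N #<= [set: univ N]) _.
    by have := card_setT (univ N); rewrite card_eq_le => /andP[].
  apply/card_leTT; exists (fun x => Sub (val (q0 x)) (q0a x)).
  by move=> x y /(congr1 val) /= /val_inj/q0I.
have ia : inhabited (below a).
  by have x0' : univ N := SigSub (mem_set Nx0); exists; exact: (Sub (val (q0 x0')) (q0a x0')).
have [q _ qI] := (card_le_fun _ _ ia).1 Na.
have [|N' _ iN'] := @image_structure _ _ _ q N; first exact/set_injP.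
have [p [ip pq _]] := isomorphism_inverse (inhabits x0) iN'.
pose t : task tau mu := existT _ a (N', [set zw | exists x,
  [/\ univ N x, univ M (g x), b (g x) = val zw.2 & zw.1 = q x]]).
have KN' : aec_K k N' by apply/(aec_K_iso k iN'); exact: (aec_le_K NN1).1.
have /sat[/= f fN' fP] : realized k M b Mx t.
  exists (g \o p) => /=.
    apply: le_embedding_comp (le_embedding_isomorphism KN' ip) _.
    exact: le_embedding_sub NN1 gN1.
  move=> z w y [x [/= Nx Mgx bw ->]] My byw.
  by rewrite pq //; apply: bI => //; rewrite bw.
exists (f \o q); split.
  apply: le_embedding_comp fN'; apply: le_embedding_isomorphism iN'.
  exact: (aec_le_K NN1).1.
move=> x Nx Mgx bc /=.
have ba : b (g x) < a by apply: lt_le_trans bc _; rewrite le_max lexx orbT.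
by apply: (fP (q x) (Sub (b (g x)) ba)) => //; exists x.
Qed.

Theorem claim1p11 (tau : vocabulary) (k : aec tau) (LST : Type)
    (hLST : is_LST k LST)
    (dmu : Order.disp_t) (mu : orderType dmu)
    (dkappa : Order.disp_t) (kappa : orderType dkappa)
    (hmu : strong_limit mu)
    (hkappa : is_cofinality mu kappa)
    (hLSTkappa : card_lt (@setT LST) (@setT kappa))
    (hmeas : measurable_cardinal kappa) :
  has_amalgamation_bases k mu kappa.
Proof.
move=> dO O O_succ.
have [kappa_card nat_kappa [D [D_ultra Dnp Dcompl]]] := hmeas.
have [kappa_wf _] := kappa_card.
have [kL _] := hLST.
have sL : small mu LST by exact: small_lt_cofinality hkappa hLSTkappa.
have [/card_leTT[sym symI] LSTA] := kL.
have sp : small mu (pred_sym tau).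
  by apply: (small_inj (f := fun R => sym (inl (inl R)))) sL => ? ? /symI[].
have sf : small mu (fun_sym tau).
  by apply: (small_inj (f := fun R => sym (inl (inr R)))) sL => ? ? /symI[].
have sn : small mu nat by apply: (small_inj (f := fun n => sym (inr n))) sL => ? ? /symI[].
have mu_inh : inhabited mu.
  by case: hmu => _ /card_leTT[f _] _; exists; exact: f 0.
have tail := measure_tail kappa_card D_ultra Dnp Dcompl.
have [k0 _] := filter_ex (filterT : D setT).
have gt (a : kappa) : exists a', a < a' by have [a' aa'] := filter_ex (tail a); exists a'.
have succ (a : kappa) : exists a', ord_succ a a'.
  by have [c ac] := gt a; exact: ord_succ_exists ac.
have [m mP] := cofinality_sequence (inhabits k0) hkappa.
have Dm z : D [set e | z < m e].
  by have [b h] := mP z; apply: measure_mono (tail b).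
(* The second component is the enumeration of [M]. Outside the ordinal models the value is
   arbitrary. *)
have /choice[F FP] : forall M : structure tau O, exists p : structure tau O * (O -> mu),
    ordinal_model k mu M -> [/\ ordinal_model k mu p.1, aec_le k M p.1,
    forall x y, univ M x -> univ M y -> p.2 x = p.2 y -> x = y &
    forall N, ordinal_model k mu N -> aec_le k p.1 N ->
      realized k M p.2 N `<=` realized k M p.2 p.1].
  move=> M; have [oM|noM] := pselect (ordinal_model k mu M).
    by have [p pP] := omodel_task_saturation hmu O_succ sp sf sn oM; exists p.
  by have [m0] := mu_inh; exists (M, fun=> m0).
exists (fun M => (F M).1); split; first by move=> M /FP[].
move=> M Mtop dbl [Mle _] unM Mtople oM oMtop hdbl MF.
(* [B a] is the ordinal 2a+1, and [C a] is 2a+2. *)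
have /choice[B BP] : forall a, exists b, ord_succ (dbl a) b by move=> a; exact: succ.
have /choice[C CP] : forall a, exists c, ord_succ (B a) c by move=> a; exact: succ.
have MC a : M (C a) = (F (M (B a))).1 := MF a _ _ (BP a) (CP a).
have aB a : a <= B a.
  exact: le_trans (ord_double_ge kappa_wf hdbl a) (ltW (BP a).1).
have Ktop : K_card k mu Mtop by split; [exact: oMtop.1|exact: omodel_card oMtop].
split=> // T1 M1 e1 T2 M2 e2 [K1 c1] e1M [K2 c2] e2M.
have pick T (N : structure tau T) : univ N #= [set: mu] -> exists t, univ N t.
  rewrite card_eq_le => /andP[_ /card_le_set_type[f _]]; have [m0] := mu_inh.
  exists (val (f (SigSub (mem_set (Logic.I : [set: mu] m0))))).
  exact: set_mem (valP _).
have [t1 M1t1] := pick _ _ c1; have [t2 M2t2] := pick _ _ c2.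
have [b1 _ b1I] : exists2 b1 : T1 -> mu, (forall x, univ M1 x -> [set: mu] (b1 x)) &
    forall x y, univ M1 x -> univ M1 y -> b1 x = b1 y -> x = y.
  by apply/(card_le_fun _ _ mu_inh); move: c1; rewrite card_eq_le => /andP[].
(* These are the approximations to [M1]. The point [t1] keeps them nonempty, and they are small
   because the segment below [m e] and [LST] are. *)
have /choice[N1 N1P] : forall e, exists N, [/\ aec_le k N M1,
    (forall x, univ M1 x -> b1 x < m e -> univ N x), univ N t1 & small mu (univ N)].
  move=> e; pose X := [set x | univ M1 x /\ (x = t1 \/ b1 x < m e)].
  have [N [NM1 XN NX]] := LSTA _ M1 X K1 (fun x => @proj1 _ _).
  exists N; split=> //; first by move=> x M1x xm; apply: XN; split=> //; right.
    by apply: XN; split=> //; left.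
  have sX : small mu X.
    pose h (x : X) : option (below (m e)) := insub (b1 (val x)).
    apply: (small_inj (f := fun x : X => if pselect (val x = t1) then None else Some (h x))).
      move=> x y; case: pselect => xt; case: pselect => yt // eq; apply: val_inj.
        by rewrite xt yt.
      have [M1x [//|bx]] := set_mem (valP x); have [M1y [//|by_]] := set_mem (valP y).
      move: eq => [] /(congr1 (omap val)); rewrite /h !insubT //= => -[].
      exact: b1I.
    by apply: (small_option hmu); apply: (small_option hmu); exact: small_below.
  move=> h; apply: (small_sum hmu sX sL); apply: card_le_trans h _.
  by apply: card_le_trans _ NX; have := card_setT (univ N); rewrite card_eq_le => /andP[].
(* Saturation speaks only of ordinal models, so [M1] is copied onto one that extends [Mtop]. *)
have [Mx [oMx MtopMx [g ig ge]]] : exists M', [/\ ordinal_model k mu M', aec_le k Mtop M' &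
    exists2 g, isomorphism g M' M1 & forall y, univ Mtop y -> g y = e1 y].
  apply: omodel_extension e1M => //.
  by move: c1; rewrite card_eq_le => /andP[].
have [_ [xO _ _]] := oMtop.
have [h [ih hg gh]] := isomorphism_inverse (inhabits xO) ig.
have hM1 : le_embedding k h M1 Mx by exact: le_embedding_isomorphism.
have sub_univ (N N' : structure tau O) : aec_le k N N' -> univ N `<=` univ N'.
  by move=> /aec_le_sub[].
have he1 y : univ Mtop y -> h (e1 y) = y.
  by move=> uy; rewrite -ge // hg //; exact: (sub_univ _ _ MtopMx).
have /choice[f fP] : forall j : kappa * kappa, exists f : T1 -> O,
    le_embedding k f (N1 j.2) Mtop /\
    forall y, univ (M (B j.1)) y -> (F (M (B j.1))).2 y < m j.2 ->
      univ (N1 j.2) (e1 y) -> f (e1 y) = y.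
  move=> [i e] /=; have [NM1 _ Nt1 sN] := N1P e.
  have [oF MFM bI sat] := FP _ (oM (B i)).
  have FMx : aec_le k (F (M (B i))).1 Mx.
    by rewrite -MC; exact: aec_le_trans (Mtople _) MtopMx.
  have [f [fN fE]] := local_embedding (m e) hmu (ex_intro _ t1 Nt1) sN bI (sat _ oMx FMx) NM1 hM1.
  exists f; split; first by apply: le_embedding_le fN _; rewrite -MC.
  move=> y My bym Ny.
  have ytop : univ Mtop y by exact: (sub_univ _ _ (Mtople (B i))).
  by rewrite fE // he1.
apply: (@amalgamation_of_local_embeddings _ k LST _ (fubini D) _ _ _ Mtop M1 M2 e1 e2 t2
  (fun j => N1 j.2) f) => //.
- exact: fubini_mono.
- exact: fubini_ultra.
- exact: fubini_neq0.
- exact: fubini_complete.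
- exact: fubini_complete.
- by move=> j; have [] := N1P j.2.
- by move=> j; have [] := fP j.
- move=> x M1x; apply: measure_mono (filterT : D setT) => i _ /=.
  apply: measure_mono (Dm (b1 x)) => e /= xm.
  by have [_ h' _ _] := N1P e; exact: h'.
(* A point [y] of the union enters at some [i0], hence lies in [M (B i)] for all later [i]. For
   fixed [i], almost all [e] put the index of [y] below [m e] and [e1 y] into [N1 e]. *)
move=> y ytop; have [u _ _] := unM; move: (ytop); rewrite u => -[i0 _ yi0].
apply: measure_mono (tail i0) => i /= i0i.
apply: measure_mono (filterI (Dm ((F (M (B i))).2 y)) (Dm (b1 (e1 y)))) => e /= [h1 h2].
have [_ N1e _ _] := N1P e; apply: (fP (i, e)).2 => //=.
  by apply: (sub_univ (M i0)) => //; apply: Mle; apply: le_trans (aB i); exact: ltW.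
apply: N1e => //; have [Q QM1 iQ] := e1M; have [s _ _] := aec_le_sub QM1.
by apply: s; rewrite (isomorphism_univ iQ); exists y.
Qed.
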